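(* Let $n\ge 2$, $t\ge 3$, $\Lambda=PG(2n-1,q^t)$, $\Sigma^*=PG(tn-1,q^t)$ containing $\Lambda$, and $\Sigma=\mathrm{Fix}(\Psi)\cong PG(tn-1,q)$ where $\Psi$ is a semilinear collineation of $\Sigma^*$ of order $t$. Let $L$ be a scattered $\mathbb{F}_q$-linear set of $\Lambda$ of pseudoregulus type with associated pseudoregulus $\mathcal P$, and suppose $L=p_{\Gamma,\Lambda}(\Sigma)$ for an $(n(t-2)-1)$-dimensional subspace $\Gamma$ of $\Sigma^*$ disjoint from $\Sigma$ and from $\Lambda$. Then: (i) the set $\mathcal D_L=\{\langle\Gamma,s\rangle_{q^t}\cap\Sigma: s\in\mathcal P\}$ is a Desarguesian $(t-1)$-spread of $\Sigma$; (ii) there exist a director space $\bar\Theta$ of $\mathcal D_L$ and an integer $m$ with $\gcd(m,t)=1$ such that, with $\tau=\Psi^m$, $$\Gamma=\langle\bar\Theta,\bar\Theta^{\tau},\dots,\bar\Theta^{\tau^{t-3}}\rangle_{q^t}.$$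
   Context: Projection: $p_{\Gamma,\Lambda}(\Sigma)=\{\langle\Gamma,P\rangle_{q^t}\cap\Lambda:P\in\Sigma\}$. Desarguesian spreads: if $\Theta$ is an $(n-1)$-dimensional subspace of $\Sigma^*$ such that $\Theta,\Theta^\Psi,\dots,\Theta^{\Psi^{t-1}}$ span $\Sigma^*$, then $\mathcal D(\Theta)=\{\langle P,P^\Psi,\dots,P^{\Psi^{t-1}}\rangle_{q^t}\cap\Sigma:P\in\Theta\}$ is a $(t-1)$-spread of $\Sigma$ (partition of its points into $(t-1)$-dimensional subspaces) called Desarguesian, and $\Theta^{\Psi^i}$, $i=0,\dots,t-1$, are its director spaces. For an $\mathbb{F}_q$-subspace $U$ of the underlying $\mathbb{F}_{q^t}$-space, $L_U=\{\langle\mathbf u\rangle_{q^t}:\mathbf u\in U\setminus\{\mathbf 0\}\}$ has rank $\dim_{\mathbb F_q}U$, the weight of $PG(W,\mathbb{F}_{q^t})$ in $L_U$ is $\dim_{\mathbb F_q}(W\cap U)$, and $L_U$ is scattered if all points have weight 1. Pseudoregulus type: for $t,n\ge 2$, a scattered $\mathbb{F}_q$-linear set $L$ of $PG(2n-1,q^t)$ of rank $tn$ such that (i) there exist $(q^{nt}-1)/(q^t-1)$ pairwise disjoint lines each of weight $t$ in $L$, and (ii) there exist exactly two $(n-1)$-dimensional subspaces $T_1,T_2$ disjoint from $L$ meeting each of these lines; the set of these lines is the pseudoregulus associated with $L$. *)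

(* Defs.v *)
(* Projective spaces are modelled by row vectors over a finite
   field K = F_{q^t}; a point is a nonzero vector up to scalars, a subspace is
   (the row space of) a square matrix, projective dimension = \rank - 1. *)
From HB Require Import structures.
From mathcomp Require Import all_boot all_order all_algebra all_field.
Set Implicit Arguments. Unset Strict Implicit. Unset Printing Implicit Defensive.
Import GRing.Theory.
Local Open Scope ring_scope.

Section PG.
Variables (K : finFieldType) (N : nat).
Implicit Types (v w u p : 'rV[K]_N) (M s T : 'M[K]_N)
  (Psi : 'rV[K]_N -> 'rV[K]_N) (U : {set 'rV[K]_N}).

Definition subfield_q (q : nat) : {set K} := [set a : K | a ^+ q == a].

Definition semilinear_collineation Psi : Prop :=
  [/\ (forall u v, Psi (u + v) = Psi u + Psi v), injective Psi &
      exists sigma : {rmorphism K -> K},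
        forall (a : K) v, Psi (a *: v) = sigma a *: Psi v].

Definition collineation_order Psi (t : nat) : Prop :=
  (forall v, (iter t Psi v <= v)%MS) /\
  (forall k, (0 < k < t)%N -> exists v, ~~ (iter k Psi v <= v)%MS).

Definition fixed_point Psi v : bool := (v != 0) && (Psi v <= v)%MS.

(* Fix(Psi) is a subgeometry isomorphic to PG(N-1,q): in some basis B of K^N
   it is the set of points with coordinates in F_q *)
Definition canonical_subgeometry (q : nat) Psi : Prop :=
  exists2 B : 'M[K]_N, B \in unitmx &
    forall v, v != 0 ->
      ((Psi v <= v)%MS <->
       exists x : 'rV[K]_N,
         [/\ x != 0, (forall j, x 0 j \in subfield_q q) & (v <= x *m B)%MS]).

Definition mapsub (f : 'rV[K]_N -> 'rV[K]_N) M : 'M[K]_N := \matrix_i f (row i M).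

Definition Fq_subspace (q : nat) U : Prop :=
  [/\ 0 \in U, (forall u v, u \in U -> v \in U -> u + v \in U) &
      (forall a u, a \in subfield_q q -> u \in U -> a *: u \in U)].

Definition linset U : {set 'rV[K]_N} :=
  [set v | (v != 0) && [exists u in U, (u != 0) && (v <= u)%MS]].

(* the subspace M has weight w in L_U : dim_{F_q}(M cap U) = w *)
Definition has_weight (q : nat) U M (w : nat) : Prop :=
  #|[set u in U | (u <= M)%MS]| = (q ^ w)%N.

Definition scattered (q : nat) U : Prop :=
  forall v, v \in linset U -> has_weight q U <<v>>%MS 1.

Definition proj_set (Gam Lam : 'M[K]_N) Psi : {set 'rV[K]_N} :=
  [set v | [&& v != 0, (v <= Lam)%MS &
            [exists w, fixed_point Psi w && (v <= (Gam + <<w>>)%MS)%MS]]].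

Definition pr_transversal (n : nat) (Lam : 'M[K]_N) U (P : {set 'M[K]_N}) T : Prop :=
  [/\ \rank T = n, (T <= Lam)%MS,
      (forall v, v \in linset U -> ~~ (v <= T)%MS) &
      (forall s, s \in P -> ((T :&: s)%MS != 0))].

Definition pseudoregulus_type (q n t : nat) (Lam : 'M[K]_N) U
    (P : {set 'M[K]_N}) : Prop :=
  [/\ [/\ Fq_subspace q U, (forall u, u \in U -> (u <= Lam)%MS),
         scattered q U & #|U| = (q ^ (t * n))%N],
      [/\ #|P| = ((q ^ (n * t) - 1) %/ (q ^ t - 1))%N,
          (forall s, s \in P -> [/\ \rank s = 2%N, (s <= Lam)%MS & has_weight q U s t]) &
          (forall s1 s2, s1 \in P -> s2 \in P -> s1 != s2 -> (s1 :&: s2 == (0 : 'M[K]_N))%MS)] &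
      exists T1 T2,
        [/\ pr_transversal n Lam U P T1, pr_transversal n Lam U P T2, ~~ (T1 == T2)%MS &
            forall T, pr_transversal n Lam U P T -> (T == T1)%MS || (T == T2)%MS]].

Definition span_orbit (f : 'rV[K]_N -> 'rV[K]_N) (k : nat) M : 'M[K]_N :=
  (\sum_(i < k) mapsub (iter i f) M)%MS.

Definition desarg_spread Psi (t : nat) M : {set {set 'rV[K]_N}} :=
  [set [set v | fixed_point Psi v && (v <= \sum_(i < t) <<iter i Psi p>>)%MS]
     | p in [set p | (p != 0) && (p <= M)%MS]].

Definition director_cond (n t : nat) Psi M : Prop :=
  \rank M = n /\ (span_orbit Psi t M == 1%:M)%MS.

Definition is_desarguesian (n t : nat) Psi (D : {set {set 'rV[K]_N}}) : Prop :=
  exists M, director_cond n t Psi M /\ D = desarg_spread Psi t M.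

Definition director_space (n t : nat) Psi (D : {set {set 'rV[K]_N}}) (Thb : 'M[K]_N) : Prop :=
  exists M, [/\ director_cond n t Psi M, D = desarg_spread Psi t M &
              exists2 i, (i < t)%N & (Thb == mapsub (iter i Psi) M)%MS].

Definition DL_of (Gam : 'M[K]_N) Psi (P : {set 'M[K]_N}) : {set {set 'rV[K]_N}} :=
  [set [set v | fixed_point Psi v && (v <= (Gam + s)%MS)%MS] | s in P].

End PG.

(* Main.v *)
(* Write Psi = c phi with phi semilinear and fixing an F_q-lattice W pointwise,
   and let pi be the projection of the whole space onto Lam along Gam.  The
   lattices U and pi(W) span the same linear set, and counting points shows that
   pi(W) is scattered with the same weights, so every w in W lies above exactly
   one line of the pseudoregulus.  Let T1, T2 be the two transversal spaces and
   H_i = Gam + T_i.  Since pseudoregulus lines meet each T_i, the bijection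
   V/H_2 -> V/H_1 induced by W maps points to points, so it is semilinear for some
   automorphism u of K.  If u fixed an element outside F_q, then T1 and T2 would
   meet every line in the same point and coincide; hence u has fixed field F_q, is
   a power s^k of the companion automorphism s of phi with k prime to t, and
   H_1 = phi^k(H_2).  Thus Gam = H_2 :&: phi^k(H_2).  By Galois descent the
   t conjugates of H_2 have trivial intersection, so
   D = phi(H_2) :&: ... :&: phi^(t-1)(H_2) has rank n, its conjugates are in direct
   sum, and Gam is the sum of t - 2 of them.  Finally w = sum_i phi^i(p) with
   p in D identifies the spread cut out by the pseudoregulus with that of D. *)
Require Import Defs.
From HB Require Import structures.
From mathcomp Require Import all_boot all_order all_algebra all_solvable all_field.
From mathcomp Require Import mxabelem zify.
Import GRing.Theory.
Local Open Scope ring_scope.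
Set Implicit Arguments. Unset Strict Implicit. Unset Printing Implicit Defensive.

(** * Finite fields and semilinear maps *)

Lemma finField_expf1 (K : finFieldType) (x : K) : x != 0 -> x ^+ #|K|.-1 = 1.
Proof.
move=> x0; apply: (mulfI x0); rewrite -exprS prednK ?expf_card ?mulr1 //.
by apply/card_gt0P; exists x.
Qed.

Lemma finField_primitive_root (K : finFieldType) :
  {g : K | #|K|.-1.-primitive_root g}.
Proof.
have n_gt0 : (0 < #|K|.-1)%N by rewrite -subn1 subn_gt0 finRing_gt1.
pose rs := enum (predC1 (0 : K)).
have szrs : size rs = #|K|.-1 by rewrite -(cardC1 (0 : K)) cardE.
suff: has (#|K|.-1).-primitive_root rs.
  by rewrite has_filter; case: filter (filter_all (#|K|.-1).-primitive_root rs)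
    => // g s /andP[gP _] _; exists g.
apply: has_prim_root => //; last by rewrite szrs.
- apply/allP => x; rewrite mem_enum => x0.
  by apply/unity_rootP/finField_expf1.
- exact: enum_uniq.
Qed.

(** The product of X - x over the [s]-orbit of a primitive root [g] has coefficients fixed by [s],
    hence by [u]. So [u g] is again a root, that is, an [s]-iterate of [g], and the powers of [g]
    exhaust the nonzero elements. *)
Lemma rmorph_iter_fixed_gen (K : finFieldType) (s u : {rmorphism K -> K}) :
  (forall a, s a = a -> u a = a) -> exists j, forall a, u a = iter j s a.
Proof.
move=> fixsu; have [g gP] := finField_primitive_root K.
pose O := fingraph.orbit s g.
pose f := \prod_(x <- O) ('X - x%:P).
have Oinj : injective s by apply: fmorph_inj.
have permO : perm_eq (map s O) O.
  apply: uniq_perm; rewrite ?orbit_uniq ?map_inj_uniq ?orbit_uniq // => x.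
  apply/mapP/idP => [[y yO ->]|].
    by rewrite -fconnect_orbit (connect_trans _ (fconnect1 _ _)) // fconnect_orbit.
  rewrite -fconnect_orbit => gx; exists (finv s x); last by rewrite f_finv.
  by rewrite -fconnect_orbit (connect_trans gx) // fconnect_finv.
have fixf : map_poly s f = f.
  rewrite /f rmorph_prod /=.
  under eq_bigr do rewrite rmorphB /= map_polyX map_polyC /=.
  by rewrite -(big_map s xpredT (fun x => 'X - x%:P)); apply: perm_big.
have fixf' : map_poly u f = f.
  apply/polyP => i; rewrite coef_map /=; apply: fixsu.
  by rewrite -{2}fixf coef_map.
have : root f (u g).
  rewrite -fixf' rmorph_root // root_prod_XsubC -fconnect_orbit; exact: connect0.
rewrite root_prod_XsubC -fconnect_orbit => /iter_findex; move: (findex _ _ _) => j ujg.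
exists j => a; have [->|a0] := eqVneq a 0.
  by rewrite rmorph0; elim: j {ujg} => //= j <-; rewrite rmorph0.
have a1 : a ^+ #|K|.-1 = 1 by apply: finField_expf1.
have [i ->] := prim_rootP gP a1.
rewrite rmorphXn -ujg; elim: j {ujg} => //= j <-; by rewrite rmorphXn.
Qed.

(** A primitive root raised to the power (|K| - 1) / (q - 1) has order q - 1; its powers together
    with 0 are q solutions of x^q = x. The opposite bound comes from scatteredness in
    [card_subfield_and_weights]. *)
Lemma leq_card_subfield_q (K : finFieldType) (q t : nat) :
  #|K| = (q ^ t)%N -> (q <= #|subfield_q K q|)%N.
Proof.
move=> cK; have [g gP] := finField_primitive_root K.
have := finRing_gt1 K; rewrite cK.
case: t q => [|t] [|[|q]] // in cK *; first by rewrite exp1n.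
move=> _.
have /dvdnP[m mP] : (q.+1 %| #|K|.-1)%N.
  by rewrite cK predn_exp /= dvdn_mulr.
have K1 : (0 < #|K|.-1)%N by rewrite -subn1 subn_gt0 finRing_gt1.
(* The original q is now [q.+2], so [q.+1] stands for q - 1; [None] gives the solution 0. *)
pose h (o : option 'I_q.+1) : K := if o is Some i then g ^+ (m * i) else 0.
have m0 : (0 < m)%N by move: K1; rewrite mP; case: (m).
have g0 : g != 0.
  by apply/eqP => g0; move: (prim_expr_order gP) => /eqP;
    rewrite g0 expr0n gtn_eqF // eq_sym oner_eq0.
have hinj : injective h.
  move=> [i|] [j|] //= /eqP; rewrite ?expf_eq0 ?(negbTE g0) ?andbF //; last first.
    by rewrite eq_sym expf_eq0 (negbTE g0) andbF.
  rewrite (eq_prim_root_expr gP) !modn_small; last 2 first.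
  - by rewrite mP ltn_pmul2l.
  - by rewrite mP ltn_pmul2l.
  by rewrite eqn_pmul2l // => /eqP/val_inj ->.
have ch : #|codom h| = q.+2 by rewrite card_codom // card_option card_ord.
rewrite -[X in (X <= _)%N]ch.
apply: subset_leq_card; apply/subsetP => _ /codomP[[i|] ->]; rewrite inE.
  rewrite /h; have -> : (g ^+ (m * i)) ^+ q.+2 = g ^+ (m * i) * (g ^+ (m * i)) ^+ q.+1
    by rewrite exprS.
  by rewrite -[X in _ * X]exprM mulnAC -mP [X in _ * X]exprM (prim_expr_order gP) expr1n mulr1.
by rewrite /= expr0n.
Qed.

(* An additive bijection matching the lines through 0 is semilinear as soon as
   the dimension is at least 2: the scalar by which [g] distorts a line is
   compared on two independent lines through their diagonal. *)
Lemma semilinear_of_lines (K : finFieldType) n (g : 'rV[K]_n -> 'rV[K]_n) :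
  (1 < n)%N -> {morph g : u v / u + v} -> injective g ->
  (forall a v, (g (a *: v) <= g v)%MS) ->
  exists s : {rmorphism K -> K}, forall a v, g (a *: v) = s a *: g v.
Proof.
move=> n1 gD ginj glin.
have g0 : g 0 = 0 by apply: (addrI (g 0)); rewrite -gD !addr0.
pose mu v a : K := odflt 0 [pick c | g (a *: v) == c *: g v].
have muP v a : g (a *: v) = mu v a *: g v.
  rewrite /mu; case: pickP => [c /eqP //|no].
  by have /sub_rVP[c gc] := glin a v; have := no c; rewrite gc eqxx.
have gn0 v : v != 0 -> g v != 0 by apply: contraNneq => gv; apply/eqP/ginj; rewrite gv.
have mu_inj v : v != 0 -> injective (mu v).
  move=> v0 a b ab; have /ginj/eqP : g (a *: v) = g (b *: v) by rewrite !muP ab.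
  by rewrite -subr_eq0 -scalerBl scaler_eq0 (negbTE v0) orbF subr_eq0 => /eqP.
have mu_ind v w a : v != 0 -> ~~ (w <= v)%MS -> mu v a = mu w a.
  move=> v0 wv; have gwv : ~~ (g w <= g v)%MS.
    apply: contra wv => /sub_rVP[b gb].
    (* An injective self-map of the finite field is onto, so proportional images come from
       proportional vectors. *)
    have /codomP[c bc] := inj_card_onto (mu_inj v v0) (leqnn _) b.
    by apply/sub_rVP; exists c; apply: ginj; rewrite muP -bc.
  have key : (mu (v + w) a - mu w a) *: g w = (mu v a - mu (v + w) a) *: g v.
    have := muP (v + w) a; rewrite scalerDr !gD !muP scalerDr => e.
    rewrite !scalerBl; apply/eqP; rewrite subr_eq addrAC -addrA eq_sym.
    by rewrite addrC addrAC subr_eq [X in X == _]addrC e addrC.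
  have e1 : mu (v + w) a = mu w a.
    apply/eqP; rewrite -subr_eq0; apply: contraR gwv => nz.
    apply/sub_rVP; exists ((mu (v + w) a - mu w a)^-1 * (mu v a - mu (v + w) a)).
    by rewrite -scalerA -key scalerK.
  by apply/eqP; move/eqP: key; rewrite e1 subrr scale0r eq_sym scaler_eq0
    (negbTE (gn0 _ v0)) orbF subr_eq0.
have mu_const v w a : v != 0 -> w != 0 -> mu v a = mu w a.
  move=> v0 w0; have [/sub_rVP[c wc]|wv] := boolP (w <= v)%MS; last exact: mu_ind.
  (* Dependent vectors are compared through a third vector off their common line, which exists
     because [n] exceeds 1. *)
  have [u uv] : exists u : 'rV_n, ~~ (u <= v)%MS.
    have : ~~ (1%:M <= v)%MS.
      by apply: contraL n1 => /mxrankS; rewrite mxrank1 -leqNgt => /leq_trans->//;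
        apply: rank_leq_row.
    by case/row_subPn => i; exists (row i 1%:M).
  have c0 : c != 0 by apply: contraNneq w0 => c0; rewrite wc c0 scale0r.
  rewrite (mu_ind v u) // (mu_ind w u) //; apply: contra uv => /submx_trans; apply.
  by rewrite wc scalemx_sub.
pose v0 : 'rV[K]_n := delta_mx 0 (Ordinal (ltnW n1)).
have v00 : v0 != 0.
  by apply/eqP => /matrixP/(_ 0 (Ordinal (ltnW n1)))/eqP; rewrite !mxE !eqxx oner_eq0.
have muE v a : g (a *: v) = mu v0 a *: g v.
  have [->|vn0] := eqVneq v 0; first by rewrite scaler0 g0 scaler0.
  by rewrite muP (mu_const v v0).
have canc a b : a *: g v0 = b *: g v0 -> a = b.
  by move/eqP; rewrite -subr_eq0 -scalerBl scaler_eq0 (negbTE (gn0 _ v00)) orbF subr_eq0 => /eqP.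
have sB : zmod_morphism (mu v0).
  have muD a b : mu v0 (a + b) = mu v0 a + mu v0 b.
    by apply: canc; rewrite -muE scalerDl gD !muE scalerDl.
  by move=> a b; apply: (addIr (mu v0 b)); rewrite -muD !subrK.
have sM : monoid_morphism (mu v0).
  split; first by apply: canc; rewrite -muE !scale1r.
  by move=> a b; apply: canc; rewrite -muE -scalerA muE muE scalerA.
pose sa := GRing.isZmodMorphism.Build K K (mu v0) sB.
pose sm := GRing.isMonoidMorphism.Build K K (mu v0) sM.
pose S : {rmorphism K -> K} := HB.pack (mu v0) sa sm.
by exists S => a v; rewrite muE.
Qed.

(** * Twisted maps and director spaces *)

Lemma mxrank_bigcap_ge (F : fieldType) (I : finType) (P : pred I) N (A : I -> 'M[F]_N) :
  (N <= \rank (\bigcap_(i | P i) A i)%MS + \sum_(i | P i) (N - \rank (A i)))%N.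
Proof.
elim/big_rec2: _ => [|i X m _ IH]; first by rewrite mxrank1 addn0.
have := mxrank_sum_cap (A i) X; have := rank_leq_col (A i + X)%MS.
have := rank_leq_col (A i); lia.
Qed.

(* The [s]-semilinear map fixing the rows of [B], on matrices with rows in the
   space: for the row basis [B] it applies [s] to the coordinates. *)
Definition twist (K : fieldType) N (B : 'M[K]_N) (s : K -> K) m (A : 'M[K]_(m, N)) :=
  map_mx s (A *m invmx B) *m B.

Section Twist.
Variables (K : fieldType) (N : nat) (B : 'M[K]_N) (s : {rmorphism K -> K}).
Hypothesis uB : B \in unitmx.
Notation phi := (twist B s).

Lemma twist_row m (A : 'M[K]_(m, N)) i : phi (row i A) = row i (phi A).
Proof. by rewrite /twist -row_mul map_row -row_mul. Qed.

Lemma iter_twist_row k m (A : 'M[K]_(m, N)) i :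
  iter k (@phi _) (row i A) = row i (iter k (@phi _) A).
Proof. by elim: k => //= k ->; rewrite twist_row. Qed.

Lemma twistD m (A C : 'M[K]_(m, N)) : phi (A + C) = phi A + phi C.
Proof. by rewrite /twist mulmxDl map_mxD mulmxDl. Qed.

Lemma twistB m (A C : 'M[K]_(m, N)) : phi (A - C) = phi A - phi C.
Proof. by rewrite /twist mulmxBl map_mxB mulmxBl. Qed.

Lemma twist0 m : phi (0 : 'M[K]_(m, N)) = 0.
Proof. by rewrite /twist mul0mx map_mx0 mul0mx. Qed.

Lemma twistZ m a (A : 'M[K]_(m, N)) : phi (a *: A) = s a *: phi A.
Proof. by rewrite /twist -scalemxAl map_mxZ -scalemxAl. Qed.

Lemma twist_sum m I (r : seq I) P (A : I -> 'M[K]_(m, N)) :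
  phi (\sum_(i <- r | P i) A i) = \sum_(i <- r | P i) phi (A i).
Proof. by apply: (big_morph _ (@twistD m) (@twist0 m)). Qed.

Lemma twist_submx m1 m2 (A : 'M[K]_(m1, N)) (C : 'M[K]_(m2, N)) :
  (phi A <= phi C)%MS = (A <= C)%MS.
Proof.
have uB' : invmx B \in unitmx by rewrite unitmx_inv.
rewrite /twist; apply/idP/idP => [|/submxMr-/(_ _ (invmx B))]; last first.
  by rewrite -(map_submx s) => /submxMr-/(_ _ B).
move=> /submxMr-/(_ _ (invmx B)); rewrite !mulmxK // map_submx.
by move=> /submxMr-/(_ _ B); rewrite !mulmxKV.
Qed.

Lemma mxrank_twist m (A : 'M[K]_(m, N)) : \rank (phi A) = \rank A.
Proof. by rewrite /twist mxrankMfree ?row_free_unit // mxrank_map mxrankMfree ?row_free_unit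
  ?unitmx_inv. Qed.

Lemma iter_twistZ k m a (A : 'M[K]_(m, N)) :
  iter k (@phi _) (a *: A) = iter k s a *: iter k (@phi _) A.
Proof. by elim: k => //= k ->; rewrite twistZ. Qed.

Lemma iter_twist_submx k m1 m2 (A : 'M[K]_(m1, N)) (C : 'M[K]_(m2, N)) :
  (iter k (@phi _) A <= iter k (@phi _) C)%MS = (A <= C)%MS.
Proof. by elim: k => //= k; rewrite twist_submx. Qed.

Lemma mxrank_iter_twist k m (A : 'M[K]_(m, N)) : \rank (iter k (@phi _) A) = \rank A.
Proof. by elim: k => //= k; rewrite mxrank_twist. Qed.

Lemma twist_basis m (x : 'M[K]_(m, N)) : phi (x *m B) = map_mx s x *m B.
Proof. by rewrite /twist mulmxK. Qed.

Lemma iter_twistE k m (A : 'M[K]_(m, N)) : iter k (@phi _) A = twist B (iter k s) A.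
Proof.
elim: k => [|k IH] /=; first by rewrite /twist map_mx_id // mulmxKV.
by rewrite IH /twist mulmxK // -map_mx_comp.
Qed.

End Twist.

Section GaloisDescent.
Variables (K : finFieldType) (N : nat) (B : 'M[K]_N) (s : {rmorphism K -> K}).
Hypothesis uB : B \in unitmx.
Notation phi := (twist B s).

(* A vector of minimal support in the basis [B], normalised to have a
   coordinate 1, is fixed: its difference with its image has smaller support. *)
Lemma twist_stable_eq0 (X : 'M[K]_N) :
  (phi X <= X)%MS -> (forall v : 'rV[K]_N, (v <= X)%MS -> phi v = v -> v = 0) -> X = 0.
Proof.
move=> stX noX; apply/eqP; apply/negPn/negP => /rowV0Pn[v0 v0X v00].
have uB' : invmx B \in unitmx by rewrite unitmx_inv.
pose supp (v : 'rV[K]_N) := [set j | (v *m invmx B) 0 j != 0].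
pose P := [pred v : 'rV[K]_N | (v <= X)%MS && (v != 0)].
have Pv0 : P v0 by rewrite /= v0X.
case: (arg_minnP (fun v => #|supp v|) Pv0) => v /andP[vX vn0] vmin.
have [j xj] : exists j, (v *m invmx B) 0 j != 0.
  apply/existsP; apply: contraNT vn0 => /existsPn h; apply/eqP.
  suff e : v *m invmx B = 0 by rewrite -(mulmxKV uB v) e mul0mx.
  by apply/rowP => j; rewrite [RHS]mxE; apply/eqP; rewrite -[_ == _]negbK h.
set c := (v *m invmx B) 0 j in xj.
pose w := c^-1 *: v.
have wX : (w <= X)%MS by rewrite scalemx_sub.
have wn0 : w != 0 by rewrite scaler_eq0 invr_eq0 (negbTE xj).
have cw i : (w *m invmx B) 0 i = c^-1 * (v *m invmx B) 0 i by rewrite -scalemxAl mxE.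
have cu i : ((phi w - w) *m invmx B) 0 i = s ((w *m invmx B) 0 i) - (w *m invmx B) 0 i.
  by rewrite mulmxBl /twist mulmxK // [LHS]mxE [X in X + _]mxE [X in _ + X]mxE.
have uX : (phi w - w <= X)%MS.
  by rewrite addmx_sub ?eqmx_opp // (submx_trans _ stX) // twist_submx.
case/eqP: wn0; apply: noX => //; apply/eqP; rewrite -subr_eq0; apply/negPn/negP => un0.
have := vmin (phi w - w); rewrite inE /= uX un0 => /(_ isT); apply/negP; rewrite -ltnNge.
apply: proper_card; apply/properP; split.
  apply/subsetP => i; rewrite !inE cu cw; apply: contra => /eqP->.
  by rewrite mulr0 rmorph0 subrr.
exists j; rewrite inE ?cu ?cw -/c ?mulVf ?rmorph1 ?subrr ?eqxx //.
Qed.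

End GaloisDescent.

(** * Director spaces from conjugates of a space without fixed vectors *)

Section Director.
Variables (K : finFieldType) (n t : nat).
Local Notation N := (t * n)%N.
Variables (B : 'M[K]_N) (s : {rmorphism K -> K}) (H : 'M[K]_N).
Hypotheses (uB : B \in unitmx) (t_gt0 : (0 < t)%N).
Notation phi := (@twist _ _ B s _).
Hypothesis st : forall a, iter t s a = a.
Hypothesis rkH : (N <= \rank H + n)%N.
Hypothesis fixH : forall v : 'rV[K]_N, (v <= H)%MS -> phi v = v -> v = 0.

Lemma iter_twist_mod k m (A : 'M[K]_(m, N)) : iter k phi A = iter (k %% t) phi A.
Proof.
have per C : iter t phi C = C :> 'M[K]_(m, N).
  by rewrite iter_twistE // /twist map_mx_id // mulmxKV.
rewrite [in LHS](divn_eq k t) addnC iterD; congr (iter _ _ _).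
by rewrite iterM; elim: (k %/ t)%N => //= j ->; rewrite per.
Qed.

(** [H] has codimension at most [n], so its t - 1 nontrivial conjugates meet in rank at least [n].
    Leaving out index 0 is what makes the result a complement of [H]. *)
Definition director : 'M[K]_N := (\bigcap_(i < t | i != 0%N :> nat) iter i phi H)%MS.

Lemma director_sub_iter i j : i != j %[mod t] -> (iter j phi director <= iter i phi H)%MS.
Proof.
(* [r] is i - j modulo [t], nonzero by hypothesis: [director] lies in phi^r H, and applying phi^j
   gives the claim. *)
move=> ij; pose r := ((i + (t - j %% t)) %% t)%N.
have jt : (j %% t < t)%N by rewrite ltn_pmod.
have er : (j + r = i %[mod t])%N.
  by rewrite modnDmr addnCA -modnDmr -(modnDml j) subnKC ?(ltnW jt) // modnn addn0.
have r0 : r != 0%N.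
  by apply: contraNneq ij => r0; rewrite -er r0 addn0.
have rt : (r < t)%N by rewrite ltn_pmod.
rewrite (iter_twist_mod i) -er -iter_twist_mod iterD iter_twist_submx //.
exact: (bigcapmx_inf (Ordinal rt)).
Qed.

(** The intersection of all conjugates of [H] is phi-stable and contains no nonzero fixed vector, so
    Galois descent makes it zero. *)
Lemma director_cap : (director :&: H)%MS = 0.
Proof.
pose X := (\bigcap_(i < t) iter i phi H)%MS.
have XP i : (X <= iter i phi H)%MS.
  by rewrite iter_twist_mod; apply: (bigcapmx_inf (Ordinal (ltn_pmod i t_gt0))).
suff X0 : X = 0.
  apply/eqP; rewrite -submx0 -X0; apply/sub_bigcapmxP => i _.
  have [i0|i0] := eqVneq (i : nat) 0%N; first by rewrite i0 capmxSr.
  by rewrite (submx_trans (capmxSl _ _)) // (bigcapmx_inf i).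
apply: (twist_stable_eq0 uB (s := s)) => [|v vX].
  (* Replacing [i] by t + i makes the exponent a successor, so that one application of phi can be
     peeled off even for i = 0. *)
  apply/sub_bigcapmxP => i _; rewrite (iter_twist_mod i) -(modnDl i) -iter_twist_mod.
  have -> : (t + i = (t + i).-1.+1)%N by rewrite prednK // addn_gt0 t_gt0.
  by rewrite /= twist_submx.
by apply: fixH; apply: submx_trans vX (XP 0%N).
Qed.

(** Counting codimensions gives rank at least [n]. The [t] conjugates are independent, since all but
    the i-th lie in phi^i H, which meets the i-th trivially; as they fit into rank t n, the rank is
    exactly [n] and they span. *)
Lemma director_rank_span :
  \rank director = n /\ (\sum_(i < t) iter i phi director :=: 1%:M)%MS.
Proof.
have rkD : (n <= \rank director)%N.
  have := mxrank_bigcap_ge (fun i : 'I_t => i != 0%N :> nat) (fun i => iter i phi H).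
  rewrite -/director (eq_bigr (fun=> (N - \rank H)%N)); last by move=> i _;
    rewrite mxrank_iter_twist.
  rewrite sum_nat_const.
  have -> : #|(fun i : 'I_t => i != 0%N :> nat)| = t.-1.
    by rewrite -[in RHS](card_ord t) -(cardC1 (Ordinal t_gt0)); apply: eq_card => i; rewrite !inE.
  have : (t.-1 * (N - \rank H) <= t.-1 * n)%N by rewrite leq_mul2l; apply/orP; right; lia.
  have : (N = n + t.-1 * n)%N by rewrite -mulSn prednK.
  lia.
have dx : mxdirect (\sum_(i < t) iter i phi director).
  apply/mxdirect_sumsP => i _; apply/eqP; rewrite -submx0.
  rewrite submx0 -mxrank_eq0 -(mxrank_iter_twist s uB (t - i)) mxrank_eq0 -submx0.
  have back C : iter (t - i) phi (iter i phi C) = C :> 'M_N.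
    by rewrite -iterD subnK 1?ltnW // iter_twist_mod modnn.
  rewrite -[X in (_ <= X)%MS]director_cap sub_capmx -[X in (_ <= X)%MS && _]back -[X in _ && (_
    <= X)%MS]back.
  rewrite !iter_twist_submx // capmxSl (submx_trans (capmxSr _ _)) //.
  apply/sumsmx_subP => j ji; apply: director_sub_iter.
  by rewrite !modn_small // eq_sym.
have := mxdirectP dx; rewrite /= (eq_bigr (fun=> \rank director)); last first.
  by move=> i _; rewrite mxrank_iter_twist.
rewrite sum_nat_const card_ord => rkS.
have := rank_leq_col (\sum_(i < t) iter i phi director)%MS.
rewrite rkS leq_pmul2l // => rkD'.
have rkDn : \rank director = n by apply/eqP; rewrite eqn_leq rkD' rkD.
split => //; apply/eqmxP; rewrite submx1 /= -(mxrank_leqif_sup (submx1 _)).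
by rewrite rkS rkDn mxrank1.
Qed.

(** As [k] is prime to [t], the spaces phi^(kj) D run over all conjugates of D. Those with j from 2
    to t - 1 lie in both H (j is not 0) and phi^k H (j is not 1), so their sum [S] lies in H :&:
    phi^k H. Ranks then force [S], this intersection and [Gam] to coincide. *)
Lemma director_cap_twist (Gam : 'M[K]_N) k :
  (2 < t)%N -> coprime k t -> \rank Gam = (n * (t - 2))%N ->
  (Gam <= H)%MS -> (Gam <= iter k phi H)%MS ->
  (Gam :=: \sum_(i < t - 2) iter (k * i) phi (iter (2 * k %% t) phi director))%MS.
Proof.
move=> t2 kt rkG GH GkH; have [rkD spanD] := director_rank_span.
set S := (\sum_(i < t - 2) _)%MS.
have k_inj i j : (k * i == k * j %[mod t]) = (i == j %[mod t]).
  wlog ij : i j / (i <= j)%N => [wl|].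
    by case/orP: (leq_total i j) => /wl // e; rewrite eq_sym e eq_sym.
  by rewrite eq_sym [RHS]eq_sym !eqn_mod_dvd ?leq_mul2l ?ij ?orbT // -mulnBr Gauss_dvdr //
    coprime_sym.
have SE i : iter (k * i) phi (iter (2 * k %% t) phi director) = iter (k * i.+2) phi director.
  by rewrite -(iter_twist_mod (2 * k)) -iterD -[i.+2]addn2 mulnDr (mulnC 2).
have Skj j : (iter (k * j) phi director <= director + iter k phi director + S)%MS.
  rewrite iter_twist_mod -modnMmr -iter_twist_mod.
  have := ltn_pmod j t_gt0; case: (j %% t)%N => [|[|i]] it.
  - by rewrite muln0 -addsmxA addsmxSl.
  - by rewrite muln1 (submx_trans _ (addsmxSl _ _)) // addsmxSr.
  rewrite (submx_trans _ (addsmxSr _ _)) //.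
  have i2 : (i < t - 2)%N by rewrite ltn_subRL.
  apply: (sumsmx_sup (Ordinal i2)) => //=.
  by rewrite SE.
have full : (1%:M <= director + iter k phi director + S)%MS.
  rewrite -spanD; apply/sumsmx_subP => i _.
  (* Chinese remaindering gives a multiple of [k] congruent to [i] modulo [t]; [j] is its quotient
     by [k]. *)
  have [j kj] : exists j, (k * j = i %[mod t])%N.
    have ctk : coprime t k by rewrite coprime_sym.
    have /dvdnP[j jE] : (k %| chinese t k i 0)%N.
      by rewrite /dvdn chinese_modr // mod0n.
    by exists j; rewrite mulnC -jE chinese_modl.
  by rewrite iter_twist_mod -kj -iter_twist_mod.
have rkS : (\rank Gam <= \rank S)%N.
  have := mxrankS full; rewrite mxrank1 => /leq_trans/(_ (mxrank_adds_leqif _ _))/=.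
  have := mxrank_adds_leqif director (iter k phi director).
  move=> [/= + _]; rewrite mxrank_iter_twist // rkD rkG => h1 h2.
  have -> : (n * (t - 2) = N - (n + n))%N by rewrite mulnBr mulnC muln2 addnn.
  lia.
have HH : (1%:M <= H + iter k phi H)%MS.
  rewrite -spanD; apply/sumsmx_subP => i _.
  have [i0|i0] := eqVneq (i : nat) 0%N; last first.
    rewrite (submx_trans _ (addsmxSl _ _)) //.
    by apply: (director_sub_iter (i := 0)); rewrite mod0n modn_small // eq_sym.
  rewrite i0 (submx_trans _ (addsmxSr _ _)) //.
  apply: (director_sub_iter (j := 0)); rewrite mod0n; apply: contraTneq kt => /eqP.
  by move=> /gcdn_idPr; rewrite /coprime => ->; case: (t) t2 => [|[|[|]]].
have rkH' : (\rank H + n <= N)%N.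
  have := mxrank_sum_cap director H; rewrite director_cap mxrank0 addn0 rkD addnC => <-.
  exact: rank_leq_col.
have SX : (S <= H :&: iter k phi H)%MS.
  apply/sumsmx_subP => i _.
  rewrite SE.
  have i2 : (i.+2 < t)%N by have := ltn_ord i; lia.
  have D j : (j < 2)%N -> (iter (k * i.+2) phi director <= iter (k * j) phi H)%MS.
    by move=> j2; apply: director_sub_iter; rewrite k_inj !modn_small //; lia.
  by have := D 0%N isT; have := D 1%N isT; rewrite muln0 muln1 sub_capmx => -> ->.
have rkX : (\rank (H :&: iter k phi H) <= \rank Gam)%N.
  have := mxrank_sum_cap H (iter k phi H); rewrite mxrank_iter_twist //.
  have := mxrankS HH; rewrite mxrank1 rkG.
  have -> : (n * (t - 2) = N - (n + n))%N by rewrite mulnBr mulnC muln2 addnn.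
  lia.
have GX : (Gam <= H :&: iter k phi H)%MS by rewrite sub_capmx GH.
have XG : (H :&: iter k phi H <= Gam)%MS by rewrite -(mxrank_leqif_sup GX) eqn_leq rkX mxrankS.
apply/eqmxP; have SG := submx_trans SX XG.
by rewrite SG andbT -(mxrank_leqif_sup SG) eqn_leq rkS mxrankS.
Qed.

End Director.

(** * Counting points of linear sets *)

Lemma rV_submxC (K : fieldType) N (u v : 'rV[K]_N) :
  u != 0 -> v != 0 -> (u <= v)%MS = (v <= u)%MS.
Proof.
have half (x y : 'rV[K]_N) : x != 0 -> (x <= y)%MS -> (y <= x)%MS.
  move=> x0 /sub_rVP[c xy]; apply/sub_rVP; exists c^-1.
  rewrite xy scalerA mulVf ?scale1r //.
  by apply: contraNneq x0 => c0; rewrite xy c0 scale0r.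
by move=> u0 v0; apply/idP/idP; apply: half.
Qed.

Lemma card_sub_nz (K : finFieldType) N (M : 'M[K]_N) :
  #|[set v : 'rV[K]_N | (v != 0) && (v <= M)%MS]| = (#|K| ^ \rank M).-1.
Proof.
rewrite -card_rowg (cardsD1 0 (rowg M)) inE sub0mx add1n /=.
by apply: eq_card => v; rewrite !inE.
Qed.

(** Incident pairs are counted twice: a nonzero vector lies in at most one member of a disjoint
    family. *)
Lemma leq_card_disjoint_family (K : finFieldType) N (P : {set 'M[K]_N})
    (X : {set 'rV[K]_N}) c :
  (forall s1 s2, s1 \in P -> s2 \in P -> s1 != s2 -> (s1 :&: s2)%MS = 0) ->
  (forall s, s \in P -> (c <= #|[set x in X | (x != 0%R) && (x <= s)%MS]|)%N) ->
  (c * #|P| <= #|[set x in X | (x != 0%R) && [exists s in P, (x <= s)%MS]]|)%N.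
Proof.
move=> dP cP; rewrite mulnC -sum_nat_const (leq_trans (leq_sum _ cP)) //.
under eq_bigr => s _ do rewrite -sum1dep_card big_mkcond /=.
rewrite exchange_big -sum1dep_card [X in (_ <= X)%N]big_mkcond /=; apply: leq_sum => x _.
case: (x \in X) => /=; last by rewrite big1.
have [->|x0] := eqVneq x 0; first by rewrite big1.
case: ifP => [/existsP[s /andP[sP xs]]|/existsPn no].
  rewrite (bigD1 s) //= xs big1 // => s' /andP[s'P ss'].
  case: ifP => // xs'; case/eqP: x0; apply/eqP; rewrite -submx0 -(dP s s') 1?eq_sym //.
  by rewrite sub_capmx xs.
by rewrite big1 // => s sP; have := no s; rewrite sP /= => /negbTE->.
Qed.

Section LinearSets.
Variables (K : finFieldType) (N : nat).
Implicit Types (U : {set 'rV[K]_N}) (M : 'M[K]_N).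

(** Pairs of a lattice vector [u] and a vector [v] on the same point are counted both ways. [linset]
    is a set of vectors, so each point contributes |K| - 1 of them. *)
Lemma linset_double_count U M :
  (\sum_(v in linset U | (v <= M)%MS) #|[set u in U | (u != 0%R) && (u <= v)%MS]| =
   #|K|.-1 * #|[set u in U | (u != 0%R) && (u <= M)%MS]|)%N.
Proof.
rewrite mulnC -sum_nat_const.
under eq_bigr => v _ do rewrite -sum1dep_card big_mkcond /=.
rewrite exchange_big [RHS]big_mkcond /=; apply: eq_bigr => u _.
rewrite [in RHS]inE; case uU: (u \in U) => /=; last by rewrite big1.
have [->|u0] := eqVneq u 0; first by rewrite big1.
rewrite /= -big_mkcondr /= sum1dep_card.
case: ifP => uM.
  have := card_sub_nz <<u>>%MS; rewrite genmxE rank_rV u0 expn1 => <-.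
  apply: eq_card => v; rewrite !inE genmxE.
  have [//|v0] := eqVneq v 0; rewrite (rV_submxC v0 u0) /=.
  case uv: (u <= v)%MS; rewrite ?andbF ?andbT //=.
  have vu : (v <= u)%MS by rewrite rV_submxC.
  rewrite (submx_trans vu uM) andbT; apply/existsP; exists u.
  by rewrite uU u0 vu.
apply: eq_card0 => v; rewrite !inE; apply/negP => /andP[/andP[/andP[v0 _] vM] uv].
by rewrite (submx_trans uv vM) in uM.
Qed.

(** Double counting over the whole space gives equal totals, so the termwise lower bound [c] is
    attained at every point; double counting over [M] then compares the weights of [M]. *)
Lemma linset_same_weights U U' c :
  linset U = linset U' -> #|U :\ 0| = #|U' :\ 0| ->
  (forall v, v \in linset U -> #|[set u in U | (u != 0) && (u <= v)%MS]| = c) ->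
  (forall v, v \in linset U -> (c <= #|[set u in U' | (u != 0%R) && (u <= v)%MS]|)%N) ->
  forall M, #|[set u in U' | (u != 0) && (u <= M)%MS]| =
            #|[set u in U | (u != 0) && (u <= M)%MS]|.
Proof.
move=> LL cU wU wU' M.
have K1 : (0 < #|K|.-1)%N by rewrite -subn1 subn_gt0 finRing_gt1.
have all1 (V : {set 'rV[K]_N}) : [set u in V | (u != 0) && (u <= (1%:M : 'M_N))%MS] = V :\ 0.
  by apply/setP => u; rewrite !inE submx1 andbT andbC.
have wE v : v \in linset U -> #|[set u in U' | (u != 0) && (u <= v)%MS]| = c.
  move=> vL; apply/eqP; rewrite eqn_leq wU' // andbT leqNgt; apply/negP => lt.
  have := linset_double_count U' 1%:M; have := linset_double_count U 1%:M.
  rewrite !all1 -cU -LL => <-; apply/eqP; rewrite gtn_eqF //.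
  have vM : (v \in linset U) && (v <= (1%:M : 'M_N))%MS by rewrite vL submx1.
  rewrite (bigD1 v vM) [X in (_ < X)%N](bigD1 v vM) /= (wU v) // -addSn leq_add //.
  by apply: leq_sum => u /andP[/andP[uL _] _]; rewrite wU // wU'.
apply/eqP; rewrite -(eqn_pmul2l K1) -!linset_double_count -LL.
by apply/eqP; apply: eq_bigr => v /andP[vL _]; rewrite wE // wU.
Qed.

End LinearSets.

(** * Semilinear maps between two coordinate images of a lattice *)

Section Transfer.
Variables (K : finFieldType) (N n : nat) (W : {set 'rV[K]_N}) (Q1 Q2 : 'M[K]_(N, n)).
Hypotheses (n_gt1 : (1 < n)%N)
  (WD : forall u v, u \in W -> v \in W -> u + v \in W)
  (WN : forall u, u \in W -> - u \in W)
  (cardW : (#|K| ^ n <= #|W|)%N)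
  (Q1W : forall w, w \in W -> w *m Q1 = 0 -> w = 0)
  (Q2W : forall w, w \in W -> w *m Q2 = 0 -> w = 0)
  (linesW : forall w w' a, w \in W -> w' \in W ->
     w' *m Q2 = a *: (w *m Q2) -> (w' *m Q1 <= w *m Q1)%MS).

Lemma transfer_surj (x : 'rV[K]_n) : exists2 w, w \in W & w *m Q2 = x.
Proof.
have inj2 : {in W &, injective (mulmx^~ Q2)}.
  move=> u v uW vW /eqP; rewrite -subr_eq0 -mulmxBl => /eqP/(Q2W (WD uW (WN vW)))/eqP.
  by rewrite subr_eq0 => /eqP.
have e : [set w *m Q2 | w in W] = [set: 'rV[K]_n].
  by apply/eqP; rewrite eqEcard subsetT cardsT card_mx mul1n card_in_imset.
have : x \in [set w *m Q2 | w in W] by rewrite e inE.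
by case/imsetP => w wW ->; exists w.
Qed.

(** [Q2] is a bijection from [W] onto K^n by cardinality. Following its inverse [h] by [Q1] gives an
    additive injection preserving points, to which [semilinear_of_lines] applies; [A] records the
    images of the unit vectors. *)
Lemma transfer_semilinear : exists s : {rmorphism K -> K},
  (forall w w' a, w \in W -> w' \in W ->
     w' *m Q2 = a *: (w *m Q2) -> w' *m Q1 = s a *: (w *m Q1)) /\
  exists A : 'M[K]_n, forall w, w \in W -> w *m Q1 = map_mx s (w *m Q2) *m A.
Proof.
have [h hW hQ] : {h : 'rV[K]_n -> 'rV[K]_N | forall x, h x \in W & forall x, h x *m Q2 = x}.
  have ex x : {w | (w \in W) && (w *m Q2 == x)}.
    apply/sigW; have [w wW wx] := transfer_surj x; exists w; by rewrite wW wx eqxx.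
  by exists (fun x => sval (ex x)) => x; case: (ex x) => w /= /andP[wW /eqP wx].
have hK w : w \in W -> h (w *m Q2) = w.
  move=> wW; apply/eqP; rewrite -subr_eq0; apply/eqP/Q2W; first by rewrite WD ?WN.
  by rewrite mulmxBl hQ subrr.
pose g x := h x *m Q1.
have hD : {morph h : x y / x + y}.
  by move=> x y; rewrite -[RHS]hK ?WD // mulmxDl !hQ.
have gD : {morph g : x y / x + y} by move=> x y; rewrite /g hD mulmxDl.
have ginj : injective g.
  move=> x y /eqP; rewrite -subr_eq0 -mulmxBl => /eqP/Q1W e.
  by rewrite -[x]hQ -[y]hQ; congr (_ *m _); apply/eqP; rewrite -subr_eq0 e // WD ?WN.
have glin a x : (g (a *: x) <= g x)%MS.
  by apply: (linesW (a := a)); rewrite ?hW ?hQ.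
have [s gs] := semilinear_of_lines n_gt1 gD ginj glin.
have gW w : w \in W -> g (w *m Q2) = w *m Q1 by move=> wW; rewrite /g hK.
exists s; split=> [w w' a wW w'W e|]; first by rewrite -!gW // e gs.
exists (\matrix_i g (row i 1%:M)) => w wW; rewrite -gW //; move: (w *m Q2) => x.
have g0 : g 0 = 0 by apply: (addrI (g 0)); rewrite -gD !addr0.
rewrite mulmx_sum_row {1}(row_sum_delta x) (big_morph g gD g0); apply: eq_bigr => i _.
by rewrite gs rowK row1 [in RHS]mxE.
Qed.

End Transfer.

Lemma mem_linset (K : finFieldType) N (U : {set 'rV[K]_N}) (u : 'rV[K]_N) :
  u \in U -> u != 0 -> u \in linset U.
Proof. by move=> uU u0; rewrite inE u0; apply/existsP; exists u; rewrite uU u0 submx_refl. Qed.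

(** The cokernel matrix of [H] has the right kernel but N columns; its column base keeps the kernel
    with only [n] columns. *)
Lemma kernel_matrix (K : fieldType) N n (H : 'M[K]_N) : (\rank H + n = N)%N ->
  exists Q : 'M[K]_(N, n), forall m (v : 'M[K]_(m, N)), (v <= H)%MS = (v *m Q == 0).
Proof.
move=> rkH; have r : \rank (cokermx H) = n by rewrite mxrank_coker; lia.
suff: exists Q : 'M[K]_(N, \rank (cokermx H)),
    forall m (v : 'M[K]_(m, N)), (v <= H)%MS = (v *m Q == 0).
  by rewrite r.
exists (col_base (cokermx H)) => m v.
rewrite submxE -{1}(mulmx_base (cokermx H)) mulmxA.
apply/eqP/eqP => [/(congr1 (mulmx^~ (pinvmx (row_base (cokermx H)))))|->]; last by rewrite mul0mx.
by rewrite mulmxKp ?row_base_free // mul0mx.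
Qed.

(** * Collineations fixing a subgeometry *)

Section NormalForm.
Variables (K : finFieldType) (N q : nat) (Psi : 'rV[K]_N -> 'rV[K]_N).
Hypotheses (N_gt1 : (1 < N)%N) (q_gt0 : (0 < q)%N).

(** The rows of [B] and their sums with the first row are fixed points, so all rows have the same
    eigenvalue [c], and semilinearity gives the formula. Testing vectors supported on two rows
    identifies the fixed elements of [s]. *)
Lemma collineation_normal_form :
  semilinear_collineation Psi -> canonical_subgeometry q Psi ->
  exists (B : 'M[K]_N) (s : {rmorphism K -> K}) (c : K),
    [/\ B \in unitmx, c != 0, forall v, Psi v = c *: twist B s v,
        forall a, (s a == a) = (a \in subfield_q K q) &
        forall v, fixed_point Psi v <->
          v != 0 /\ exists2 w : 'rV_N, twist B s w = w & (v <= w)%MS].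
Proof.
move=> [PD Pinj [s Ps]] [B uB Pfix].
have P0 : Psi 0 = 0 by apply: (addrI (Psi 0)); rewrite -PD !addr0.
pose b i := row i B.
have bE i : b i = delta_mx 0 i *m B by rewrite -rowE.
have Binj (x y : 'rV_N) : x *m B = y *m B -> x = y.
  by move/(congr1 (mulmx^~ (invmx B))); rewrite !mulmxK.
have mulB0 (x : 'rV_N) : (x *m B == 0) = (x == 0).
  by apply/eqP/eqP => [|->]; rewrite ?mul0mx // -[RHS](mul0mx _ B) => /Binj.
have q0 : (0 : K) \in subfield_q K q by rewrite inE expr0n gtn_eqF.
have q1 : (1 : K) \in subfield_q K q by rewrite inE expr1n.
have Pfix' (x : 'rV_N) : x != 0 -> (forall j, x 0 j \in subfield_q K q) ->
    exists d, Psi (x *m B) = d *: (x *m B).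
  move=> x0 xq; have [|_ h] := Pfix (x *m B); first by rewrite mulB0.
  by apply/sub_rVP/h; exists x.
have dn0 i : delta_mx 0 i != 0 :> 'rV[K]_N.
  by apply/eqP => /matrixP/(_ 0 i)/eqP; rewrite !mxE !eqxx oner_eq0.
pose i0 : 'I_N := Ordinal (ltnW N_gt1); pose i1 : 'I_N := Ordinal N_gt1.
have i10 : i1 != i0 by [].
have Pe i : exists e, Psi (b i) = e *: b i.
  by rewrite bE; apply: Pfix' => // j; rewrite mxE; case: (_ && _).
have coef i (x0 x1 y0 y1 : K) : i != i0 ->
    x0 *: b i0 + x1 *: b i = y0 *: b i0 + y1 *: b i -> x0 = y0 /\ x1 = y1.
  move=> ii0; rewrite !bE !scalemxAl -!mulmxDl => /Binj/matrixP e.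
  have := e 0 i; have := e 0 i0.
  by rewrite !mxE !eqxx /= (negbTE ii0) [i0 == i]eq_sym (negbTE ii0) /= !mulr1 !mulr0 !addr0 !add0r.
have [c Pc] := Pe i0.
have twoq i (a : K) : i != i0 -> a \in subfield_q K q ->
    exists d, Psi (b i0 + a *: b i) = d *: (b i0 + a *: b i).
  move=> ii0 aq; rewrite !bE scalemxAl -mulmxDl; apply: Pfix'.
    apply/eqP => /matrixP/(_ 0 i0)/eqP.
    by rewrite !mxE !eqxx /= [i0 == i]eq_sym (negbTE ii0) mulr0 addr0 oner_eq0.
  move=> j; rewrite !mxE /=; have [->|ji0] := eqVneq j i0.
    by rewrite [i0 == i]eq_sym (negbTE ii0) mulr0 addr0.
  by case: (j == i); rewrite ?mulr1 ?mulr0 add0r.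
have Pb i : Psi (b i) = c *: b i.
  have [->//|ii0] := eqVneq i i0; have [e Pi] := Pe i.
  have [d] := twoq i 1 ii0 q1; rewrite !scale1r PD Pc Pi scalerDr => /(coef _ _ _ _ _ ii0).
  by case=> -> ->.
have c0 : c != 0.
  apply: contraTneq (dn0 i0) => c0; rewrite negbK -mulB0 -bE; apply/eqP/Pinj.
  by rewrite P0 Pc c0 scale0r.
have PE v : Psi v = c *: twist B s v.
  rewrite -{1}(mulmxKV uB v) /twist !mulmx_sum_row (big_morph Psi PD P0) scaler_sumr.
  by apply: eq_bigr => i _; rewrite Ps -/(b i) Pb !scalerA mulrC [in RHS]mxE.
have sq a : (s a == a) = (a \in subfield_q K q).
  apply/eqP/idP => [sa|aq].
    (* If [s a = a], this vector is a fixed point, hence proportional to one with F_q-coordinates,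
       and [a] is the ratio of two of these coordinates. *)
    have v0 : b i0 + a *: b i1 != 0.
      apply/negP => /eqP v0; have [] := coef i1 1 a 0 0 i10; last by move/eqP; rewrite oner_eq0.
      by rewrite scale1r v0 !scale0r addr0.
    have [+ _] := Pfix _ v0; rewrite PD Ps !Pb sa scalerA mulrC -scalerA -scalerDr.
    case=> [|x [x0 xq /sub_rVP[l]]]; first by rewrite scalemx_sub.
    rewrite !bE !scalemxAl -!mulmxDl => /Binj/matrixP e.
    have := e 0 i0; have := e 0 i1; rewrite !mxE !eqxx /= mulr1 mulr0 addr0 add0r => -> lx.
    have x00 : x 0 i0 != 0 by apply: contra_eq_neq lx => ->; rewrite mulr0 oner_eq0.
    have lE : l = (x 0 i0)^-1 by rewrite -[LHS](mulfK x00) -lx mul1r.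
    have := xq i0; have := xq i1; rewrite lE !inE => /eqP e1 /eqP e0.
    by rewrite exprMn exprVn e0 e1.
  have [d] := twoq i1 a i10 aq; rewrite PD Ps !Pb scalerDr !scalerA => /(coef _ _ _ _ _ i10).
  by case=> <-; rewrite mulrC => /(mulfI c0).
exists B, s, c; split => // v; split=> [/andP[v0 Pv]|[v0 [w ww /sub_rVP[l vE]]]].
  split=> //; have [/(_ Pv)[x [x0 xq vx]] _] := Pfix v v0.
  exists (x *m B) => //; rewrite twist_basis //; congr (_ *m _).
  by apply/rowP => j; rewrite mxE; apply/eqP; rewrite sq.
have l0 : l != 0 by apply: contraNneq v0 => l0; rewrite vE l0 scale0r.
rewrite /fixed_point v0 PE vE twistZ ww scalemx_sub // scalemx_sub //=.
by apply/sub_rVP; exists l^-1; rewrite scalerA mulVf // scale1r.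
Qed.

Lemma iter_collineation B (s : {rmorphism K -> K}) c :
  B \in unitmx -> c != 0 -> (forall v, Psi v = c *: twist B s v) ->
  forall i, exists2 d, d != 0 & forall v, iter i Psi v = d *: iter i (@twist _ _ B s _) v.
Proof.
move=> uB c0 PE; elim=> [|i [d d0 IH]]; first by exists 1; rewrite ?oner_eq0 // => v;
  rewrite scale1r.
exists (c * s d); first by rewrite mulf_neq0 // fmorph_eq0.
by move=> v; rewrite /= IH PE twistZ scalerA.
Qed.

(** Iterates of [Psi] are scalar multiples of twists by iterates of [s], and such a twist fixes
    every point only if its automorphism is the identity. *)
Lemma collineation_order_field t B (s : {rmorphism K -> K}) c :
  B \in unitmx -> c != 0 -> (forall v, Psi v = c *: twist B s v) ->
  collineation_order Psi t ->
  (forall a, iter t s a = a) /\ (forall i, (0 < i < t)%N -> ~ (forall a, iter i s a = a)).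
Proof.
move=> uB c0 PE [ordt ordi]; have itP := iter_collineation uB c0 PE; split=> [a|i /ordi[v] /negP].
  (* A coordinate 1 pins down the scalar, and a coordinate [a] then compares the t-th iterate of [s]
     at [a] with [a] itself. *)
  pose x : 'rV[K]_N := \row_j (if j == 0%N :> nat then 1 else a).
  have [d d0 dP] := itP t.
  have /sub_rVP[e] := ordt (x *m B).
  rewrite dP iter_twistE // /twist mulmxK // !scalemxAl => /(congr1 (mulmx^~ (invmx B))).
  rewrite !mulmxK // => /matrixP ex.
  have s1 i : iter i s 1 = 1 by elim: i => //= i ->; rewrite rmorph1.
  have := ex 0 (Ordinal (ltnW N_gt1)); have := ex 0 (Ordinal N_gt1).
  rewrite !mxE /= s1 !mulr1 => + de; rewrite de => /mulfI-> //.
  by rewrite -de.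
move=> nv sid; apply: nv; have [d d0 dP] := itP i.
by rewrite dP iter_twistE // /twist map_mx_id // mulmxKV // scalemx_sub.
Qed.

End NormalForm.

(** The order of [f] is exactly [t], so k j is 1 modulo [t]: remainder 0 would make [f] the
    identity, and a remainder above 1 would make a smaller positive iterate trivial. *)
Lemma iter_order_coprime (T : Type) (f : T -> T) t k j :
  (1 < t)%N -> (forall a, iter t f a = a) ->
  (forall i, (0 < i < t)%N -> ~ (forall a, iter i f a = a)) ->
  (forall a, iter (k * j) f a = f a) -> coprime k t.
Proof.
move=> t1 ft fi fkj.
have fmod i a : iter i f a = iter (i %% t) f a.
  rewrite [in LHS](divn_eq i t) addnC iterD iterM; congr iter.
  by elim: (i %/ t)%N => //= m ->; rewrite ft.
have r1 : ((k * j) %% t)%N = 1%N.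
  have := ltn_pmod (k * j) (ltnW t1); have fr a : iter ((k * j) %% t) f a = f a by rewrite -fmod.
  case: (_ %% t)%N fr => [|[//|r]] fr rt.
    by case: (fi 1%N) => //= a; rewrite -fr.
  case: (fi r.+1); first by rewrite /= (ltnW rt).
  move=> a; have [b <-] : exists b, f b = a.
    by exists (iter t.-1 f a); rewrite -iterS prednK ?ft // ltnW.
  by rewrite -iterSr fr.
by have := coprimeMl t k j; rewrite -coprime_modl r1 coprime1n => /esym/andP[].
Qed.

(** * The projected subgeometry *)

Lemma card_sub_row (K : finFieldType) N (v : 'rV[K]_N) : v != 0 ->
  #|[set x : 'rV[K]_N | (x <= v)%MS]| = #|K|.
Proof.
move=> v0; have := card_rowg <<v>>%MS; rewrite genmxE rank_rV v0 expn1 => <-.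
by apply: eq_card => x; rewrite !inE genmxE.
Qed.

Lemma card_sub_cone (K : finFieldType) N q (U : {set 'rV[K]_N}) v :
  (0 < q)%N ->
  (forall a u, a \in subfield_q K q -> u \in U -> a *: u \in U) -> v \in linset U ->
  (#|subfield_q K q|.-1 <= #|[set u in U | (u != 0%R) && (u <= v)%MS]|)%N.
Proof.
move=> q0 UZ; rewrite inE => /andP[v0 /existsP[u /and3P[uU u0 vu]]].
have F0 : (0 : K) \in subfield_q K q by rewrite inE expr0n gtn_eqF.
rewrite (cardsD1 0) F0 add1n /= -(card_imset _ (_ : injective (fun a => a *: u))).
  apply: subset_leq_card; apply/subsetP => _ /imsetP[a /setD1P[a0 aq] ->].
  by rewrite inE UZ // scaler_eq0 negb_or a0 u0 scalemx_sub // rV_submxC.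
move=> a b /eqP; rewrite -subr_eq0 -scalerBl scaler_eq0 (negbTE u0) orbF subr_eq0.
by move/eqP.
Qed.

Section Projection.
Variables (K : finFieldType) (q n t : nat).
Local Notation N := (t * n)%N.
Variables (B : 'M[K]_N) (s : {rmorphism K -> K}) (Lam Gam : 'M[K]_N).
Hypotheses (n_gt1 : (1 < n)%N) (t_gt2 : (2 < t)%N) (cK : #|K| = (q ^ t)%N).
Hypothesis uB : B \in unitmx.
Hypothesis fix_s : forall a, (s a == a) = (a \in subfield_q K q).
Hypotheses (rkLam : \rank Lam = (2 * n)%N) (rkGam : \rank Gam = (n * (t - 2))%N)
  (GamLam : (Gam :&: Lam)%MS = 0).
Notation phi := (@twist _ _ B s _).

(** This is the F_q-span of the rows of [B]; its nonzero vectors represent the points of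
    Fix(Psi). *)
Definition fixed_lattice : {set 'rV[K]_N} := [set w | phi w == w].
Local Notation W := fixed_lattice.
Local Notation pi := (proj_mx Lam Gam).
Hypothesis fixGam : forall w, w \in W -> (w <= Gam)%MS -> w = 0.

Let q_gt1 : (1 < q)%N.
Proof.
have := finRing_gt1 K; rewrite cK; case: q t t_gt2 => [|[|q']] [|t'] // _.
- by rewrite exp0n.
- by rewrite exp1n.
Qed.
Let q_gt0 : (0 < q)%N := ltnW q_gt1.
Let t_gt0 : (0 < t)%N := ltnW (ltnW t_gt2).

Lemma fixed_latticeD u v : u \in W -> v \in W -> u + v \in W.
Proof. by rewrite !inE twistD => /eqP-> /eqP->. Qed.

Lemma fixed_latticeN u : u \in W -> - u \in W.
Proof. by rewrite !inE -scaleN1r twistZ rmorphN1 => /eqP->. Qed.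

Lemma fixed_latticeZ a u : a \in subfield_q K q -> u \in W -> a *: u \in W.
Proof. by rewrite -fix_s !inE twistZ => /eqP-> /eqP->. Qed.

Lemma row_fixed_lattice i : row i B \in W.
Proof. by rewrite inE rowE twist_basis // map_delta_mx. Qed.

Lemma card_fixed_lattice : #|W| = (#|subfield_q K q| ^ N)%N.
Proof.
pose f (h : {ffun 'I_N -> K}) : 'rV[K]_N := (\row_j h j) *m B.
have finj : injective f.
  move=> h1 h2 /(congr1 (mulmx^~ (invmx B))); rewrite !mulmxK // => /matrixP e.
  by apply/ffunP => j; have := e 0 j; rewrite !mxE.
have -> : (#|subfield_q K q| ^ N)%N = #|f @: ffun_on (mem (subfield_q K q))|.
  by rewrite card_imset // card_ffun_on card_ord.
apply: eq_card => w; rewrite inE; apply/eqP/imsetP => [ww|[h /ffun_onP hF ->]].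
  exists [ffun j => (w *m invmx B) 0 j].
    apply/ffun_onP => j; rewrite ffunE -fix_s; apply/eqP.
    by rewrite -[in RHS]ww /twist mulmxK // [RHS]mxE.
  rewrite /f -[LHS](mulmxKV uB); congr (_ *m _).
  by apply/rowP => j; rewrite [RHS]mxE ffunE.
rewrite /f twist_basis //; congr (_ *m _); apply/rowP => j; rewrite !mxE.
by apply/eqP; rewrite fix_s.
Qed.

Lemma sub_Lam_Gam m (v : 'M[K]_(m, N)) : (v <= Lam + Gam)%MS.
Proof.
apply: submx_full; rewrite /row_full.
have := mxrank_sum_cap Lam Gam; rewrite capmxC GamLam mxrank0 addn0 => ->.
rewrite rkLam rkGam; apply/eqP; clear -t_gt2; nia.
Qed.

Let capLG : (Lam :&: Gam)%MS = 0. Proof. by rewrite capmxC. Qed.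

Lemma pi_Gam m (v : 'M[K]_(m, N)) : (v <= Gam)%MS -> v *m pi = 0.
Proof. exact: proj_mx_0. Qed.

Lemma sub_add_Gam m m' (v : 'M[K]_(m, N)) (S : 'M[K]_(m', N)) :
  (S <= Lam)%MS -> (v <= Gam + S)%MS = (v *m pi <= S)%MS.
Proof.
move=> SL; apply/idP/idP => [/submxMr-/(_ _ pi)|h].
  by rewrite addsmxMr (pi_Gam (submx_refl Gam)) adds0mx (proj_mx_id capLG SL).
rewrite -(subrK (v *m pi) v) addmx_sub_adds //.
exact: proj_mx_compl_sub (sub_Lam_Gam v).
Qed.

Lemma pi_inj : {in W &, injective (mulmx^~ pi)}.
Proof.
move=> u v uW vW /eqP; rewrite -subr_eq0 -mulmxBl => /eqP e.
apply/eqP; rewrite -subr_eq0; apply/eqP/fixGam; first by rewrite fixed_latticeD ?fixed_latticeN.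
by have := @proj_mx_compl_sub _ _ _ _ _ _ (sub_Lam_Gam (u - v)); rewrite e subr0.
Qed.

(** A second lattice for the given linear set. It need not equal the given one, so weights are
    carried over by counting. *)
Definition projected_lattice : {set 'rV[K]_N} := [set w *m pi | w in W].

Lemma projected_lattice_linset (Psi : 'rV[K]_N -> 'rV[K]_N) :
  (forall v, fixed_point Psi v <->
     v != 0 /\ exists2 w : 'rV_N, phi w = w & (v <= w)%MS) ->
  linset projected_lattice = proj_set Gam Lam Psi.
Proof.
move=> fixP; apply/setP => v; rewrite !inE; case: (v != 0) => //=.
apply/existsP/andP => [[_ /andP[/imsetP[w wW ->] /andP[w0 vw]]]|].
  split; first by rewrite (submx_trans vw) ?proj_mx_sub.
  apply/existsP; exists w; rewrite (submx_trans vw); last first.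
    rewrite -[X in (X <= _)%MS](subKr w) addrC addmx_sub_adds ?genmxE //.
    by rewrite eqmx_opp (proj_mx_compl_sub (sub_Lam_Gam w)).
  rewrite andbT; apply/fixP; split; first by apply: contraNneq w0 => ->; rewrite mul0mx.
  by exists w => //; apply/eqP; move: wW; rewrite inE.
case=> vL /existsP[w' /andP[/fixP[w'0 [w ww w'w]] vw']].
exists (w *m pi); have wW : w \in W by rewrite inE ww.
rewrite (imset_f (mulmx^~ pi) wW) /=; apply/andP; split.
  apply: contraNneq w'0 => w0; have e : w = 0.
    by apply: pi_inj; rewrite ?w0 ?mul0mx // inE twist0.
  by move: w'w; rewrite e => /sub_rVP[a ->]; rewrite scaler0.
rewrite -(proj_mx_id capLG vL); have /submxMr-/(_ _ pi) := vw'.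
rewrite addsmxMr (pi_Gam (submx_refl Gam)) adds0mx => /submx_trans; apply; apply: submxMr.
by rewrite genmxE.
Qed.

Variables (U : {set 'rV[K]_N}) (P : {set 'M[K]_N}).
Hypotheses (prU : pseudoregulus_type q n t Lam U P)
  (linU : linset U = linset projected_lattice).

(** A point of the scattered set carries only q - 1 nonzero vectors of [U], among them all nonzero
    multiples of one by [subfield_q K q]; this bounds that set by q. Both lattices then have q^(tn)
    elements, and [linset_same_weights] applies. *)
Lemma card_subfield_and_weights : #|subfield_q K q| = q /\
  forall M : 'M[K]_N, #|[set u in projected_lattice | (u != 0) && (u <= M)%MS]| =
                      #|[set u in U | (u != 0) && (u <= M)%MS]|.
Proof.
have [[[U0 UD UZ] _ scU cU] _ _] := prU.
have wU v : v \in linset U -> #|[set u in U | (u != 0) && (u <= v)%MS]| = q.-1.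
  move=> /scU; rewrite /has_weight expn1 (cardsD1 0) inE U0 sub0mx add1n => <- /=.
  by apply: eq_card => u; rewrite !inE genmxE; case: (u == 0); rewrite ?andbF.
have cF : #|subfield_q K q| = q.
  apply/eqP; rewrite eqn_leq (leq_card_subfield_q cK) andbT.
  have [u] : exists u, u \in U :\ 0.
    apply/set0Pn; rewrite -card_gt0; have := cardsD1 0 U; rewrite U0 cU add1n => e.
    by rewrite -ltnS -e -[X in (X < _)%N](exp1n N) ltn_exp2r // muln_gt0 t_gt0 ltnW.
  case/setD1P => u0 uU; have := card_sub_cone q_gt0 UZ (mem_linset uU u0).
  rewrite wU ?mem_linset //; clear -q_gt0; lia.
split=> //; apply: (linset_same_weights (c := q.-1)) => //.
- have z : (0 : 'rV[K]_N) \in projected_lattice.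
    by apply/imsetP; exists 0; rewrite ?mul0mx // inE twist0.
  have := cardsD1 0 U; have := cardsD1 0 projected_lattice; rewrite U0 z cU.
  rewrite card_in_imset ?card_fixed_lattice ?cF; last exact: pi_inj.
  by move=> -> [].
- move=> v; rewrite linU -cF => vL; apply: card_sub_cone => // a u aq /imsetP[w wW ->].
  by rewrite scalemxAl (imset_f (mulmx^~ pi)) // fixed_latticeZ.
Qed.

Let cF : #|subfield_q K q| = q := card_subfield_and_weights.1.
Let same_weights := card_subfield_and_weights.2.

Let cW : #|W| = (#|K| ^ n)%N.
Proof. by rewrite card_fixed_lattice cF cK -expnM. Qed.

Let W0 : 0 \in W. Proof. by rewrite inE twist0. Qed.

Let pi_eq0 w : w \in W -> (w *m pi == 0) = (w == 0).
Proof.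
move=> wW; apply/eqP/eqP => [w0|->]; last by rewrite mul0mx.
by apply: pi_inj; rewrite // w0 mul0mx.
Qed.

Let piU w : w \in W -> w *m pi \in projected_lattice.
Proof. by move=> wW; apply: (imset_f (mulmx^~ pi)). Qed.

Lemma card_fixed_lattice_line l : l \in P ->
  #|[set w in W | (w *m pi <= l)%MS]| = #|K|.
Proof.
have [[[U0 _ _] _ _ _] [_ Pl _] _] := prU; move=> /Pl[_ _]; rewrite /has_weight cK => <-.
rewrite (cardsD1 0) [RHS](cardsD1 0) !inE U0 twist0 eqxx mul0mx !sub0mx; congr (_ + _)%N.
transitivity #|[set u in U | (u != 0) && (u <= l)%MS]|; last first.
  by apply: eq_card => u; rewrite !inE andbCA.
rewrite -same_weights -(card_in_imset (f := mulmx^~ pi)); last first.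
  move=> u v; rewrite !inE => /and3P[_ uW _] /and3P[_ vW _].
  by apply: pi_inj; rewrite inE.
apply: eq_card => u; rewrite inE; apply/imsetP/and3P => [[w] |[/imsetP[w wW ->]] w0 wl].
  by rewrite in_setD1 !in_set => /and3P[w0 ww wl] ->; rewrite piU ?pi_eq0 ?inE.
by exists w => //; rewrite in_setD1 in_set wW wl -pi_eq0 // w0.
Qed.

Lemma fixed_lattice_line l : l \in P ->
  exists w, [/\ w \in W, w != 0 & (w *m pi <= l)%MS].
Proof.
move=> lP; have : exists w, w \in [set w in W | (w *m pi <= l)%MS] :\ 0.
  apply/set0Pn; rewrite -card_gt0 -ltnS.
  have := cardsD1 0 [set w in W | (w *m pi <= l)%MS].
  rewrite card_fixed_lattice_line // inE W0 mul0mx sub0mx add1n => <-.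
  exact: finRing_gt1.
by case=> w; rewrite in_setD1 in_set => /and3P[w0 wW wl]; exists w.
Qed.

Let Pdisj l1 l2 : l1 \in P -> l2 \in P -> l1 != l2 -> (l1 :&: l2)%MS = 0.
Proof. by have [_ [_ _ Pd] _] := prU => l1P l2P /(Pd _ _ l1P l2P)/andP[];
  rewrite submx0 => /eqP. Qed.

Let cP : (#|K|.-1 * #|P|)%N = (#|K| ^ n).-1.
Proof.
have [_ [-> _ _] _] := prU; rewrite cK -expnM (mulnC n) mulnC !subn1 divnK //.
by rewrite expnM (predn_exp (q ^ t) n) dvdn_mulr.
Qed.

(** The disjoint lines of [P] carry |K| - 1 nonzero projected vectors each, |K|^n - 1 in all, which
    is every nonzero vector of the projected lattice. *)
Lemma pseudoregulus_cover w : w \in W -> w != 0 -> exists2 l, l \in P & (w *m pi <= l)%MS.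
Proof.
move=> wW w0.
have : (#|K|.-1 * #|P| <= #|[set x in projected_lattice |
    (x != 0%R) && [exists l in P, (x <= l)%MS]]|)%N.
  apply: (leq_card_disjoint_family Pdisj) => l lP.
  rewrite same_weights; have [[[U0 _ _] _ _ _] [_ /(_ l lP)[_ _ +] _] _] := prU.
  rewrite /has_weight -cK (cardsD1 0) inE U0 sub0mx add1n => <- /=.
  by rewrite leq_eqVlt; apply/orP; left; apply/eqP/eq_card => u; rewrite !inE andbCA.
rewrite cP; set X := [set _ in _ | _] => cX.
have sX : X \subset projected_lattice :\ 0.
  by apply/subsetP => u; rewrite !inE => /and3P[-> -> _].
have /eqP eX : X == projected_lattice :\ 0.
  rewrite eqEcard sX (leq_trans _ cX) //.
  have z : 0 \in projected_lattice by rewrite -[X in X \in _](mul0mx _ pi) piU.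
  have := cardsD1 0 projected_lattice; rewrite z card_in_imset ?cW; last exact: pi_inj.
  by rewrite add1n => ->.
have : w *m pi \in X by rewrite eX in_setD1 pi_eq0 // w0 piU.
by rewrite inE => /and3P[_ _ /existsP[l /andP[lP wl]]]; exists l.
Qed.

(** A point of [X] on each of the disjoint lines already yields |K|^n - 1 nonzero vectors. Applied
    to [T1 :&: T2], this forces two transversal spaces to coincide. *)
Lemma meets_pseudoregulus_rank (X : 'M[K]_N) :
  (forall l, l \in P -> (X :&: l)%MS != 0) -> (n <= \rank X)%N.
Proof.
move=> Xl; have : (#|K|.-1 * #|P| <= #|[set x in rowg X |
    (x != 0%R) && [exists l in P, (x <= l)%MS]]|)%N.
  apply: (leq_card_disjoint_family Pdisj) => l lP.
  have := card_sub_nz (X :&: l)%MS.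
  have -> : [set v : 'rV_N | (v != 0) && (v <= X :&: l)%MS] =
            [set x in rowg X | (x != 0) && (x <= l)%MS].
    by apply/setP => v; rewrite !inE sub_capmx andbCA.
  move=> ->; rewrite -!subn1 leq_sub2r // -[X in (X <= _)%N]expn1 leq_exp2l ?finRing_gt1 //.
  by rewrite lt0n mxrank_eq0 Xl.
rewrite cP => cX.
have : (#|K| ^ n <= #|K| ^ \rank X)%N.
  have := card_sub_nz X; have := expn_gt0 #|K| n; have := expn_gt0 #|K| (\rank X).
  have K0 := finRing_gt1 K; rewrite (ltnW K0) /= => h1 h2 h3.
  rewrite -(prednK h1) -(prednK h2) ltnS (leq_trans cX) // -h3 subset_leq_card //.
  by apply/subsetP => u; rewrite !inE => /and3P[-> -> _].
by rewrite leq_exp2l // finRing_gt1.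
Qed.

(** The q - 1 nonzero F_q-multiples of [w *m pi] exhaust the lattice vectors on this point of weight
    one. *)
Lemma projection_scattered w w' a : w \in W -> w != 0 -> w' \in W ->
  w' *m pi = a *: (w *m pi) -> a \in subfield_q K q.
Proof.
move=> wW w0 w'W e; have [->|a0] := eqVneq a 0; first by rewrite inE expr0n gtn_eqF.
have u0 : w *m pi != 0 by rewrite pi_eq0.
have uL : w *m pi \in linset U by rewrite linU mem_linset // piU.
have [[[U0 _ _] _ scU _] _ _] := prU.
pose Y := [set u in projected_lattice | (u != 0) && (u <= <<w *m pi>>)%MS].
pose Z := [set b *: (w *m pi) | b in subfield_q K q :\ 0].
have F0 : (0 : K) \in subfield_q K q by rewrite inE expr0n gtn_eqF.
have Zinj : injective (fun b => b *: (w *m pi)).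
  move=> b c /eqP; rewrite -subr_eq0 -scalerBl scaler_eq0 (negbTE u0) orbF subr_eq0.
  by move/eqP.
have ZY : Z = Y.
  apply/eqP; rewrite eqEcard; apply/andP; split.
    apply/subsetP => _ /imsetP[b /setD1P[b0 bq] ->].
    rewrite inE scalemxAl piU ?fixed_latticeZ // -scalemxAl scaler_eq0 negb_or b0 u0.
    by rewrite scalemx_sub // genmxE.
  have eF := cardsD1 0 (subfield_q K q); rewrite F0 cF add1n in eF.
  rewrite card_imset // /Y same_weights -ltnS -eF.
  have := scU _ uL; rewrite /has_weight expn1 => <-.
  rewrite [X in (_ <= X)%N](cardsD1 0) inE U0 sub0mx add1n ltnS.
  by rewrite leq_eqVlt; apply/orP; left; apply/eqP/eq_card => u; rewrite !inE andbCA.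
have : w' *m pi \in Y.
  by rewrite inE piU // e scaler_eq0 negb_or a0 u0 genmxE scalemx_sub.
by rewrite -ZY e => /imsetP[b /setD1P[_ bq] /Zinj->].
Qed.

(** * The quotient by the centre and a transversal space *)

Section Transversal.
Variables (T : 'M[K]_N) (Q : 'M[K]_(N, n)).
Hypotheses (trT : pr_transversal n Lam U P T)
  (kerQ : forall m (v : 'M[K]_(m, N)), (v <= Gam + T)%MS = (v *m Q == 0)).

Lemma transversal_rank : (\rank (Gam + T) + n = N)%N.
Proof.
have [rkT TL _ _] := trT; have := mxrank_sum_cap Gam T.
have -> : (Gam :&: T)%MS = 0 by apply/eqP; rewrite -submx0 -GamLam capmxS.
rewrite mxrank0 addn0 rkT rkGam => ->; clear -t_gt2; nia.
Qed.

Lemma fixed_lattice_transversal w : w \in W -> w *m Q = 0 -> w = 0.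
Proof.
have [_ TL noT _] := trT => wW /eqP; rewrite -kerQ sub_add_Gam // => wT.
apply: contraTeq wT => w0; apply: noT.
by rewrite linU mem_linset ?piU ?pi_eq0.
Qed.

Lemma mul_pi_transversal (v : 'rV[K]_N) : v *m Q = v *m pi *m Q.
Proof.
apply/eqP; rewrite -subr_eq0 -mulmxBl -kerQ.
by rewrite (submx_trans (proj_mx_compl_sub (sub_Lam_Gam v))) // addsmxSl.
Qed.

(* A line of the pseudoregulus meets the transversal space, so [Q] maps it to a
   single point. *)
Lemma transversal_line l (v1 v2 : 'rV[K]_N) : l \in P ->
  (v1 *m pi <= l)%MS -> (v2 *m pi <= l)%MS -> v2 *m Q != 0 -> (v1 *m Q <= v2 *m Q)%MS.
Proof.
move=> lP; have [_ [_ /(_ l lP)[rkl _ _] _] _] := prU; have [_ _ _ /(_ l lP) Tl] := trT.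
rewrite (mul_pi_transversal v1) (mul_pi_transversal v2) => /submxMr-/(_ _ Q) v1l /submxMr-/(_ _
  Q) v2l v20.
apply: submx_trans v1l _; rewrite -(mxrank_leqif_sup v2l) eqn_leq mxrankS //=.
rewrite rank_rV v20; have := mxrank_mul_ker l Q; rewrite rkl.
have : (0 < \rank (l :&: kermx Q))%N.
  rewrite lt0n mxrank_eq0 -submx0; apply: contra Tl; rewrite -submx0 => /(submx_trans _); apply.
  rewrite sub_capmx capmxSr sub_kermx -kerQ.
  by rewrite (submx_trans (capmxSl _ _)) // addsmxSr.
clear; lia.
Qed.

(** The |K| lattice vectors over [l] are mapped injectively by [Q] into the |K| multiples of
    [w *m Q], so every multiple is attained. *)
Lemma transversal_param l w a : l \in P -> w \in W -> w != 0 -> (w *m pi <= l)%MS ->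
  exists w', [/\ w' \in W, (w' *m pi <= l)%MS & w' *m Q = a *: (w *m Q)].
Proof.
move=> lP wW w0 wl; pose X := [set w in W | (w *m pi <= l)%MS].
have wQ0 : w *m Q != 0 by apply: contra_neq w0; apply: fixed_lattice_transversal.
have Qinj : {in X &, injective (mulmx^~ Q)}.
  move=> u v; rewrite !in_set => /andP[uW _] /andP[vW _] /eqP; rewrite -subr_eq0 -mulmxBl.
  move=> /eqP/fixed_lattice_transversal e; apply/eqP; rewrite -subr_eq0 e //.
  by rewrite inE twistB (eqP uW) (eqP vW).
have eX : mulmx^~ Q @: X = [set x : 'rV[K]_n | (x <= w *m Q)%MS].
  apply/eqP; rewrite eqEcard card_in_imset // card_fixed_lattice_line // card_sub_row // leqnn
    andbT.
  apply/subsetP => _ /imsetP[u + ->]; rewrite !in_set => /andP[_ ul].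
  exact: (transversal_line lP ul wl).
have : a *: (w *m Q) \in mulmx^~ Q @: X by rewrite eX inE scalemx_sub.
case/imsetP => w' + e; rewrite in_set => /andP[w'W w'l].
by exists w'.
Qed.

End Transversal.

Hypotheses (s_t : forall a, iter t s a = a)
  (s_lt : forall i, (0 < i < t)%N -> ~ (forall a, iter i s a = a)).

(* Both quotients by [Gam + T1] and [Gam + T2] are in bijection with the lattice,
   and the lines of the pseudoregulus are the points of both; the transition map
   is therefore semilinear, for an automorphism with the same fixed field as [s]. *)
Lemma transversal_twist T1 T2 :
  pr_transversal n Lam U P T1 -> pr_transversal n Lam U P T2 -> ~~ (T1 == T2)%MS ->
  exists2 k, coprime k t & (Gam <= iter k phi (Gam + T2)%MS)%MS.
Proof.
move=> tr1 tr2 T12.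
have [Q1 kQ1] := kernel_matrix (transversal_rank tr1).
have [Q2 kQ2] := kernel_matrix (transversal_rank tr2).
have inj1 := fixed_lattice_transversal tr1 kQ1.
have inj2 := fixed_lattice_transversal tr2 kQ2.
have lines w w' a : w \in W -> w' \in W ->
    w' *m Q2 = a *: (w *m Q2) -> (w' *m Q1 <= w *m Q1)%MS.
  move=> wW w'W e; have [w0|w0] := eqVneq w 0.
    by rewrite (inj2 w') ?mul0mx ?sub0mx // e w0 mul0mx scaler0.
  have [l lP wl] := pseudoregulus_cover wW w0.
  have [w'' [w''W w''l e'']] := transversal_param tr2 kQ2 a lP wW w0 wl.
  have -> : w' = w''.
    apply/eqP; rewrite -subr_eq0; apply/eqP/inj2; first by rewrite fixed_latticeD ?fixed_latticeN.
    by rewrite mulmxBl e e'' subrr.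
  apply: (transversal_line tr1 kQ1 lP w''l wl).
  by apply: contra_neq w0; apply: inj1.
have cW' : (#|K| ^ n <= #|W|)%N by rewrite cW.
have [u [uP [A uA]]] := transfer_semilinear n_gt1 fixed_latticeD fixed_latticeN cW' inj1 inj2 lines.
have su a : s a = a -> u a = a.
  move/eqP; rewrite fix_s => aq.
  have [w wW w0] : exists2 w, w \in W & w != 0.
    have N_gt0 : (0 < N)%N by rewrite muln_gt0 t_gt0 ltnW.
    exists (row (Ordinal N_gt0) B); first exact: row_fixed_lattice.
    apply/eqP => /(congr1 (mulmx^~ (invmx B)))/matrixP/(_ 0 (Ordinal N_gt0))/eqP.
    by rewrite rowE mulmxK // mul0mx !mxE !eqxx oner_eq0.
  have := uP w (a *: w) a wW (fixed_latticeZ aq wW) (esym (scalemxAl _ _ _)).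
  rewrite -scalemxAl => /eqP; rewrite -subr_eq0 -scalerBl scaler_eq0 subr_eq0.
  by case/orP => [/eqP<-//|/eqP/inj1 e]; rewrite e ?eqxx in w0.
have us a : u a = a -> s a = a.
  move=> ua; apply/eqP; rewrite fix_s; apply: contraR T12 => aq.
  have [rk1 T1L _ _] := tr1; have [rk2 T2L _ _] := tr2.
  suff: (n <= \rank (T1 :&: T2))%N.
    move=> rkn; have eqT (T : 'M_N) : (T1 :&: T2 <= T)%MS -> \rank T = n -> (T <= T1 :&: T2)%MS.
      by move=> sT rkT; rewrite -(mxrank_leqif_sup sT) eqn_leq mxrankS //= rkT.
    have s1 := eqT _ (capmxSl _ _) rk1; have s2 := eqT _ (capmxSr _ _) rk2.
    by rewrite (submx_trans s1 (capmxSr _ _)) (submx_trans s2 (capmxSl _ _)).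
  apply: meets_pseudoregulus_rank => l lP.
  have [w [wW w0 wl]] := fixed_lattice_line lP.
  have [w' [w'W w'l e2]] := transversal_param tr2 kQ2 a lP wW w0 wl.
  have e1 := uP _ _ _ wW w'W e2; rewrite ua in e1.
  (* Both quotients scale [w] to [w'] by the same [a], so [z] lies on [l], [T1] and [T2]. It is
     nonzero because [a] is outside F_q. *)
  pose z := (w' - a *: w) *m pi.
  have zl : (z <= l)%MS by rewrite /z mulmxBl -scalemxAl addmx_sub ?eqmx_opp // scalemx_sub.
  have z1 : (z <= T1)%MS by rewrite -sub_add_Gam // kQ1 mulmxBl -scalemxAl e1 subrr.
  have z2 : (z <= T2)%MS by rewrite -sub_add_Gam // kQ2 mulmxBl -scalemxAl e2 subrr.
  have z0 : z != 0.
    apply: contraNneq aq => /eqP; rewrite /z mulmxBl -scalemxAl subr_eq0 => /eqP.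
    exact: projection_scattered.
  apply: contraNneq z0 => c0; rewrite -submx0 -c0 !sub_capmx z1 z2 zl //.
have [k uk] := rmorph_iter_fixed_gen su.
have [j sj] := rmorph_iter_fixed_gen us.
exists k.
  (* [u] is the k-th iterate of [s] and [s] the j-th iterate of [u], so the iterate of [s] of order
     k j is [s] itself. *)
  apply: (@iter_order_coprime K s t k j) => // [|a]; first exact: ltnW.
  rewrite mulnC iterM [RHS]sj.
  have ext (f g : K -> K) i x : f =1 g -> iter i f x = iter i g x.
    by move=> fg; elim: i => //= i ->.
  by apply: ext => x; rewrite uk.
have -> : iter k phi (Gam + T2)%MS = twist B u (Gam + T2)%MS.
  by rewrite iter_twistE // /twist; congr (_ *m _); apply/matrixP => i i'; rewrite !mxE uk.
(* The rows of [B] lie in the lattice, so the semilinear transition between the quotients becomes a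
   matrix identity; it sends the kernel of [Q2] into that of [Q1]. *)
have BQ : B *m Q1 = map_mx u (B *m Q2) *m A.
  by apply/row_matrixP => i; rewrite !row_mul uA ?row_fixed_lattice // -map_row row_mul.
have s21 : (twist B u (Gam + T2)%MS <= Gam + T1)%MS.
  rewrite kQ1 /twist -mulmxA BQ mulmxA -map_mxM mulmxA mulmxKV //.
  have /eqP -> : (Gam + T2)%MS *m Q2 == 0 by rewrite -kQ2.
  by rewrite map_mx0 mul0mx.
apply: (submx_trans (addsmxSl _ T1)).
rewrite -(mxrank_leqif_sup s21) mxrank_twist //.
by have := transversal_rank tr1; have := transversal_rank tr2; lia.
Qed.

(** * The spread cut out by the pseudoregulus *)

Section Spread.
Variables (T : 'M[K]_N) (Q : 'M[K]_(N, n)) (Psi : 'rV[K]_N -> 'rV[K]_N).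
Hypotheses (trT : pr_transversal n Lam U P T)
  (kerQ : forall m (v : 'M[K]_(m, N)), (v <= Gam + T)%MS = (v *m Q == 0))
  (iterPsi : forall i, exists2 d, d != 0 & forall v, iter i Psi v = d *: iter i phi v)
  (fixP : forall v, fixed_point Psi v <->
     v != 0 /\ exists2 w : 'rV_N, phi w = w & (v <= w)%MS).
Local Notation H := (Gam + T)%MS.
Local Notation D := (director B s H).

Lemma fixed_lattice_not_sub (v : 'rV[K]_N) : (v <= H)%MS -> phi v = v -> v = 0.
Proof.
move=> vH vv; apply: (fixed_lattice_transversal trT kerQ); first by rewrite inE vv.
by apply/eqP; rewrite -kerQ.
Qed.

Let rkH : (N <= \rank H + n)%N. Proof. by rewrite transversal_rank. Qed.

Lemma iter_director_sub (p : 'rV[K]_N) i :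
  (0 < i < t)%N -> (p <= D)%MS -> (iter i phi p <= H)%MS.
Proof.
move=> /andP[i0 it] pD; apply: (@submx_trans _ _ _ _ _ _ (iter i phi D)).
  by rewrite iter_twist_submx.
apply: (director_sub_iter H uB t_gt0 s_t (i := 0)).
by rewrite mod0n modn_small // eq_sym -lt0n.
Qed.

Lemma director_mul_eq0 (p : 'rV[K]_N) : (p <= D)%MS -> p *m Q = 0 -> p = 0.
Proof.
move=> pD /eqP; rewrite -kerQ => pH; apply/eqP; rewrite -submx0.
by rewrite -(director_cap uB t_gt0 s_t fixed_lattice_not_sub) sub_capmx pD.
Qed.

(** D has rank [n] and meets the kernel H of [Q] trivially, so [Q] restricts to an isomorphism on
    D. *)
Lemma director_mul_surj (x : 'rV[K]_n) : exists2 p : 'rV_N, (p <= D)%MS & p *m Q = x.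
Proof.
have [rkD _] := director_rank_span uB t_gt0 s_t rkH fixed_lattice_not_sub.
suff full : row_full (D *m Q).
  have /submxP[y ->] := submx_full x full.
  by exists (y *m D); rewrite ?submxMl // mulmxA.
have := mxrank_mul_ker D Q; rewrite rkD.
have -> : (D :&: kermx Q)%MS = 0.
  apply/eqP; rewrite -submx0 -(director_cap uB t_gt0 s_t fixed_lattice_not_sub).
  by rewrite capmxS // kerQ mulmx_ker.
by rewrite mxrank0 addn0 /row_full => ->.
Qed.

(** The trace of [p] under the cyclic group generated by phi. For [p] in D every term but the first
    lies in H, so [Q] sees only [p]; hence each lattice vector is the trace of a vector of D. *)
Definition orbit_sum (p : 'rV[K]_N) : 'rV[K]_N := \sum_(i < t) iter i phi p.

Lemma orbit_sum_fixed p : orbit_sum p \in W.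
Proof.
rewrite inE /orbit_sum twist_sum.
(* Splitting off the first term on one side and the last on the other compares the sum with its
   image; both split terms are [p]. *)
have : \sum_(i < t.+1) iter i phi p = \sum_(i < t.+1) iter i phi p by [].
rewrite {1}big_ord_recl big_ord_recr /= (iter_twist_mod uB s_t t) modnn /= addrC.
by move/addrI => e; apply/eqP.
Qed.

Lemma orbit_sum_mul (p : 'rV[K]_N) : (p <= D)%MS -> orbit_sum p *m Q = p *m Q.
Proof.
move=> pD; rewrite /orbit_sum mulmx_suml (bigD1 (Ordinal t_gt0)) //= big1 ?addr0 // => i i0.
apply/eqP; rewrite -kerQ iter_director_sub // ltn_ord andbT lt0n.
exact: i0.
Qed.

Lemma orbit_sumE w p : w \in W -> (p <= D)%MS -> p *m Q = w *m Q -> w = orbit_sum p.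
Proof.
move=> wW pD e; apply/eqP; rewrite -subr_eq0; apply/eqP.
apply: (fixed_lattice_transversal trT kerQ).
  by rewrite fixed_latticeD ?fixed_latticeN ?orbit_sum_fixed.
by rewrite mulmxBl orbit_sum_mul // e subrr.
Qed.

(** A fixed point is replaced by its lattice vector [w1]. If [w1] lies over [l], it is the trace of
    a multiple of [p]. Conversely, the span of the conjugates of [p] lies in <p> + H, so [w1 *m Q]
    is a multiple of [w *m Q], which [transversal_param] lifts to a lattice vector over [l];
    injectivity of [Q] on the lattice makes it [w1]. *)
Lemma spread_elementE l w p : l \in P -> w \in W -> w != 0 -> (w *m pi <= l)%MS ->
  (p <= D)%MS -> p *m Q = w *m Q ->
  [set v | fixed_point Psi v && (v <= (Gam + l)%MS)%MS] =
  [set v | fixed_point Psi v && (v <= \sum_(i < t) <<iter i Psi p>>)%MS].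
Proof.
move=> lP wW w0 wl pD e; have wQ0 : w *m Q != 0.
  by apply: contra_neq w0; apply: (fixed_lattice_transversal trT kerQ).
have [_ [_ /(_ l lP)[_ lL _] _] _] := prU.
apply/setP => v; rewrite !in_set; case fv: (fixed_point Psi v) => //=.
have /fixP[v0 [w1 ww1 vw1]] := fv.
have w1W : w1 \in W by rewrite inE ww1.
have w10 : w1 != 0 by apply: contraNneq v0 => w10; move: vw1; rewrite w10 => /sub_rVP[a ->];
  rewrite scaler0.
have w1v : (w1 <= v)%MS by rewrite rV_submxC.
have red m (X : 'M[K]_(m, N)) : (v <= X)%MS = (w1 <= X)%MS.
  by apply/idP/idP; apply: submx_trans.
rewrite !red sub_add_Gam //; apply/idP/idP => [w1l|w1S].
  have /sub_rVP[a ea] := transversal_line trT kerQ lP w1l wl wQ0.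
  have -> : w1 = orbit_sum (a *: p).
    by apply: orbit_sumE; rewrite ?scalemx_sub // -scalemxAl e ea.
  apply: summx_sub => i _; apply: (sumsmx_sup i) => //; rewrite genmxE iter_twistZ.
  have [d d0 ->] := iterPsi i; rewrite scalemx_sub //.
  by apply/sub_rVP; exists d^-1; rewrite scalerA mulVf // scale1r.
have /sub_rVP[a ea] : (w1 *m Q <= w *m Q)%MS.
  have : (w1 <= <<p>> + H)%MS.
    apply: submx_trans w1S _; apply/sumsmx_subP => i _; rewrite genmxE.
    have [d d0 ->] := iterPsi i; rewrite scalemx_sub //.
    have [->|i0] := eqVneq (i : nat) 0%N.
      by rewrite (submx_trans _ (addsmxSl _ _)) ?genmxE.
    rewrite (submx_trans _ (addsmxSr _ _)) // iter_director_sub // lt0n i0 /=.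
    exact: ltn_ord.
  move=> /submxMr-/(_ _ Q); rewrite addsmxMr.
  have /eqP -> : H *m Q == 0 by rewrite -kerQ.
  rewrite addsmx0 => /submx_trans; apply; rewrite -e; apply: submxMr; by rewrite genmxE.
have [w2 [w2W w2l e2]] := transversal_param trT kerQ a lP wW w0 wl.
have -> : w1 = w2; last by [].
apply/eqP; rewrite -subr_eq0; apply/eqP/(fixed_lattice_transversal trT kerQ).
  by rewrite fixed_latticeD ?fixed_latticeN.
by rewrite mulmxBl ea e2 subrr.
Qed.

Lemma DL_spread : DL_of Gam Psi P = desarg_spread Psi t D.
Proof.
apply/setP => S; apply/imsetP/imsetP => [[l lP ->]|[p]].
  have [w [wW w0 wl]] := fixed_lattice_line lP.
  have [p pD e] := director_mul_surj (w *m Q).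
  exists p; last exact: spread_elementE e.
  rewrite inE pD andbT; apply: contraNneq w0 => p0.
  by apply/eqP/(fixed_lattice_transversal trT kerQ) => //; rewrite -e p0 mul0mx.
rewrite inE => /andP[p0 pD] ->.
have w0 : orbit_sum p != 0.
  apply: contraNneq p0 => o0; apply/eqP/director_mul_eq0 => //.
  by rewrite -orbit_sum_mul // o0 mul0mx.
have [l lP wl] := pseudoregulus_cover (orbit_sum_fixed p) w0.
exists l => //; symmetry; apply: spread_elementE wl _ _ => //; first exact: orbit_sum_fixed.
by rewrite orbit_sum_mul.
Qed.

Lemma mapsub_iter i (M : 'M[K]_N) : (mapsub (iter i Psi) M :=: iter i phi M)%MS.
Proof.
have [d d0 dP] := iterPsi i.
have -> : mapsub (iter i Psi) M = d *: iter i phi M.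
  by apply/row_matrixP => j; rewrite rowK dP iter_twist_row linearZ.
exact: eqmx_scale.
Qed.

Lemma director_cond_DL : director_cond n t Psi D.
Proof.
have [rkD spanD] := director_rank_span uB t_gt0 s_t rkH fixed_lattice_not_sub.
split=> //; apply/eqmxP; apply: eqmx_trans spanD; apply: eqmx_sums => i _.
exact: mapsub_iter.
Qed.

End Spread.

End Projection.

Theorem theorem3p11 (K : finFieldType) (q n t : nat)
    (Psi : 'rV[K]_(t * n) -> 'rV[K]_(t * n)) (Lam Gam : 'M[K]_(t * n))
    (U : {set 'rV[K]_(t * n)}) (P : {set 'M[K]_(t * n)}) :
  (2 <= n)%N -> (3 <= t)%N -> #|K| = (q ^ t)%N ->
  semilinear_collineation Psi -> collineation_order Psi t -> canonical_subgeometry q Psi ->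
  \rank Lam = (2 * n)%N -> \rank Gam = (n * (t - 2))%N ->
  (forall v, fixed_point Psi v -> ~~ (v <= Gam)%MS) ->
  (Gam :&: Lam == (0 : 'M[K]_(t * n)))%MS ->
  pseudoregulus_type q n t Lam U P ->
  linset U = proj_set Gam Lam Psi ->
  is_desarguesian n t Psi (DL_of Gam Psi P) /\
  exists (Thb : 'M[K]_(t * n)) (m : nat),
    [/\ director_space n t Psi (DL_of Gam Psi P) Thb, coprime m t &
        (Gam == span_orbit (iter m Psi) (t - 2) Thb)%MS].
Proof.
move=> n_gt1 t_gt2 cK PsiS PsiO PsiC rkL rkG GamW GL prU linU.
have N_gt1 : (1 < t * n)%N by nia.
have q_gt0 : (0 < q)%N.
  have := finRing_gt1 K; rewrite cK lt0n; apply: contraTneq => ->.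
  by rewrite exp0n // (ltn_trans _ t_gt2).
have [B [s [c [uB c0 PE fix_s fixP]]]] := collineation_normal_form N_gt1 q_gt0 PsiS PsiC.
have [s_t s_lt] := collineation_order_field N_gt1 uB c0 PE PsiO.
have iterPsi := iter_collineation uB c0 PE.
have GamLam : (Gam :&: Lam)%MS = 0 by apply/eqP; rewrite -submx0; case/andP: GL.
have fixGam w : w \in fixed_lattice B s -> (w <= Gam)%MS -> w = 0.
  rewrite inE => /eqP ww; apply: contraTeq => w0; apply: GamW; apply/fixP; split=> //.
  by exists w.
rewrite -(projected_lattice_linset t_gt2 rkL rkG GamLam fixGam fixP) in linU.
have [_ _ [T1 [T2 [tr1 tr2 T12 _]]]] := prU.
have [k kt Gk] := transversal_twist n_gt1 t_gt2 cK uB fix_s rkL rkG GamLam fixGam prU linU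
  s_t s_lt tr1 tr2 T12.
have rkH := transversal_rank t_gt2 rkG GamLam tr2.
have [Q kerQ] := kernel_matrix rkH.
set D := director B s (Gam + T2)%MS.
have Dcond : director_cond n t Psi D.
  exact: (director_cond_DL t_gt2 uB rkL rkG GamLam fixGam linU s_t tr2 kerQ iterPsi).
have DLE : DL_of Gam Psi P = desarg_spread Psi t D.
  exact: (DL_spread n_gt1 t_gt2 cK uB fix_s rkL rkG GamLam fixGam prU linU
            s_t tr2 kerQ iterPsi fixP).
split; first by exists D.
have t_gt0 : (0 < t)%N by rewrite (ltn_trans _ t_gt2).
(* D and phi^k D are the two conjugates left out of [Gam], so the chain starts at exponent 2k,
   reduced modulo [t] because a director space carries an index below [t]. *)
exists (iter (2 * k %% t) (@twist _ _ B s _) D), k; split => //.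
  exists D; split=> //; exists (2 * k %% t)%N; first by rewrite ltn_pmod.
  by apply/eqmxP/eqmx_sym/mapsub_iter.
have Tfix := fixed_lattice_not_sub t_gt2 rkL rkG GamLam fixGam linU tr2 kerQ.
have rkH' : (t * n <= \rank (Gam + T2)%MS + n)%N by rewrite rkH.
have GamE := director_cap_twist uB t_gt0 s_t rkH' Tfix t_gt2 kt rkG (addsmxSl _ _) Gk.
have mapsubM i (M : 'M[K]_(t * n)) : mapsub (iter i (iter k Psi)) M = mapsub (iter (k * i) Psi) M.
  by apply/row_matrixP => j; rewrite !rowK (mulnC k) iterM.
apply/eqmxP; apply: eqmx_trans GamE _; apply: eqmx_sums => i _.
by rewrite mapsubM; apply/eqmx_sym/mapsub_iter.
Qed.
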